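(* Let $n\ge2$ be an integer and $p>1$. Fix $M>0$ and $\gamma_1,\gamma_2\in(0,1)$. Then there exist two constants $\bar s\in(0,1)$ and $C>0$ such that, given any $s\in[\bar s,1)$ and $R>0$, it holds $$(k-h)\Big[|B_R\cap\{u\le h\}|\,|B_R\cap\{u\ge k\}|\Big]^{\frac{n-1}n}\le CR^{n-2+s}(1-s)^{1/p}[u]_{W^{s,p}(B_R)}|B_R\cap\{h<u<k\}|^{\frac{p-1}p},$$ for any two real numbers $h<k$ and any $u\in W^{s,p}(B_R)$ satisfying $$\|u\|^p_{L^p(B_R)}+(1-s)R^{sp}[u]^p_{W^{s,p}(B_R)}\le MR^n(k-h)^p,$$ $$|B_R\cap\{u\le h\}|\ge\gamma_1|B_R|\quad\text{and}\quad|B_R\cap\{u\ge k\}|\ge\gamma_2|B_R|.$$ The constant $C$ depends only on $n$ and $p$, while $\bar s$ may also depend on $M$, $\gamma_1$ and $\gamma_2$.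
   Context: $B_R$ is the open ball of radius $R$ centered at the origin of $\mathbb{R}^n$; $|\cdot|$ is Lebesgue measure. $[u]_{W^{s,p}(U)}:=\big(\int_U\int_U\frac{|u(x)-u(y)|^p}{|x-y|^{n+sp}}dx\,dy\big)^{1/p}$ and $W^{s,p}(U)=\{u\in L^p(U):[u]_{W^{s,p}(U)}<\infty\}$. *)

(* Defs.v *)
From HB Require Import structures.
From mathcomp Require Import all_boot all_order all_algebra.
From mathcomp Require Import all_classical all_reals all_analysis.

Set Implicit Arguments.
Unset Strict Implicit.
Unset Printing Implicit Defensive.

Import Order.TTheory GRing.Theory Num.Theory.
Import numFieldNormedType.Exports.

Local Open Scope classical_set_scope.
Local Open Scope ring_scope.

Section lebesgue_tuple.
Context (R : realType).

(* The library's lebesgue_measure lives on measurableTypeR R, which is R with a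
   convertible sigma-algebra but another display. *)
Definition tcons n (x : measurableTypeR R * n.-tuple R) : n.+1.-tuple R :=
  [tuple of x.1 :: x.2].

Lemma measurable_tcons n : measurable_fun setT (@tcons n).
Proof.
apply: (@measurable_cons _ _ _ R (fun x : measurableTypeR R * n.-tuple R => x.1)).
  exact: measurable_fst.
exact: measurable_snd.
Qed.

Section step.
Context n (m : {sigma_finite_measure set (n.-tuple R) -> \bar R}).

Definition lebesgue_step : set (n.+1.-tuple R) -> \bar R :=
  pushforward (@lebesgue_measure R \x m)%E (@tcons n).

Let lebesgue_step0 : lebesgue_step set0 = 0%E.
Proof. by apply: measure0 => //; exact: measurable_tcons. Qed.

Let lebesgue_step_ge0 A : (0 <= lebesgue_step A)%E.
Proof. by apply: measure_ge0 => //; exact: measurable_tcons. Qed.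

Let lebesgue_step_sigma_additive : semi_sigma_additive lebesgue_step.
Proof. by apply: measure_semi_sigma_additive => //; exact: measurable_tcons. Qed.

HB.instance Definition _ := isMeasure.Build _ _ _ lebesgue_step
  lebesgue_step0 lebesgue_step_ge0 lebesgue_step_sigma_additive.

Let lebesgue_step_sigma_finite : sigma_finite setT lebesgue_step.
Proof.
have /sigma_finiteP[F [TF ndF Foo]] := sigma_finiteT (@lebesgue_measure R).
have /sigma_finiteP[G [TG ndG Goo]] := sigma_finiteT m.
pose g (t : n.+1.-tuple R) : measurableTypeR R * n.-tuple R := (thead t, [tuple of behead t]).
have gK : cancel (@tcons n) g.
  by move=> [x t]; congr pair; apply: val_inj.
have mg : measurable_fun setT g.
  apply/measurable_fun_pairP; split; first exact: measurable_tnth.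
  exact: measurable_behead.
exists (fun i => g @^-1` (F i `*` G i)).
  apply/seteqP; split => // t _.
  have : (\bigcup_i F i) (g t).1 by rewrite -TF.
  have : (\bigcup_i G i) (g t).2 by rewrite -TG.
  move=> [j _ Gj] [i _ Fi]; exists (maxn i j) => //; split => /=.
    by move: Fi; exact/subsetPset/ndF/leq_maxl.
  by move: Gj; exact/subsetPset/ndG/leq_maxr.
move=> i; have [mF Foo'] := Foo i; have [mG Goo'] := Goo i; split.
  by rewrite -[X in measurable X]setTI; apply: mg => //; exact: measurableX.
rewrite /lebesgue_step /pushforward.
have -> : @tcons n @^-1` (g @^-1` (F i `*` G i)) = F i `*` G i.
  by rewrite -comp_preimage (_ : g \o _ = id)//; apply/funext => x; exact: gK.
by rewrite product_measure1E// lte_mul_pinfty// ge0_fin_numE.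
Qed.

HB.instance Definition _ :=
  Measure_isSigmaFinite.Build _ _ _ lebesgue_step lebesgue_step_sigma_finite.

End step.

(* Lebesgue measure on the product Borel sigma-algebra of R^n, as an iterated
   product; the measure on R^0 is the unit mass. *)
Fixpoint borel_lebesgue n : {sigma_finite_measure set (n.-tuple R) -> \bar R} :=
  if n is n'.+1 then lebesgue_step (borel_lebesgue n')
  else \d_[tuple].

End lebesgue_tuple.

Section sobolev.
Context (R : realType).
Local Open Scope ereal_scope.

(* R^n with the sigma-algebra of Lebesgue measurable sets, that is, the
   completion of the product Borel sigma-algebra. *)
Definition Rn n : Type := caratheodory_type (borel_lebesgue R n)^*%mu.

HB.instance Definition _ n := Measurable.on (Rn n).

Definition lebesgue n : set (Rn n) -> \bar R :=
  @completed_measure_extension _ _ _ (borel_lebesgue R n).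

HB.instance Definition _ n := Measure.on (@lebesgue n).

Definition coord n (x : Rn n) (i : 'I_n) : R := tnth (x : n.-tuple R) i.

(* Euclidean distance; the library's norms on products are sup norms. *)
Definition euclid_dist n (x y : Rn n) : R :=
  Num.sqrt (\sum_(i < n) (coord x i - coord y i) ^+ 2)%R.

Definition origin n : Rn n := [tuple 0%R | i < n].

Definition eball n (r : R) : set (Rn n) := [set x | (euclid_dist x (@origin n) < r)%R].

Definition Lp_norm n (p : R) (U : set (Rn n)) (u : Rn n -> R) : \bar R :=
  'N[@lebesgue n]_p%:E [EFin \o (u \_ U)].

(* On the diagonal the quotient is 0 / 0 = 0. *)
Definition seminormW n (s p : R) (U : set (Rn n)) (u : Rn n -> R) : \bar R :=
  (\int[@lebesgue n]_(y in U) \int[@lebesgue n]_(x in U)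
     (`|u x - u y| `^ p / euclid_dist x y `^ (n%:R + s * p))%:E) `^ p^-1.

Definition sobolevW n (s p : R) (U : set (Rn n)) : set (Rn n -> R) :=
  [set u | [/\ measurable_fun U u, Lp_norm p U u < +oo
             & seminormW s p U u < +oo]].

End sobolev.
Arguments lebesgue {R} n.
Arguments eball {R} n r.

(* Main.v *)
Require Import Defs.
From HB Require Import structures.
From mathcomp Require Import all_boot all_order all_algebra.
From mathcomp Require Import all_classical all_reals all_analysis.
From mathcomp Require Import measurable_realfun ring lra zify.

(* A direct, quantitative argument at a fixed scale 1/N replaces the passage to
   the limit s -> 1. Truncate u to w with values in [0, 1], equal to 0 on
   A = {u <= h} and to 1 on B = {u >= k}.
   - Midpoint convexity gives F(2t) <= 2^(n+p) F(t) for
     F(t) = \iint_{|x-y|<t} |w(x)-w(y)|^p over B_R x B_R. Comparing the Gagliardo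
     energy with the dyadic scales 2^-j t, j < 1/(1-s), each of which contributes
     at least a constant times t^-(n+sp) F(t), yields
     F(t) <= C_p t^(n+sp) (1-s) [w]^p.
   - Joining x in A to y in B by N equal steps along the segment, and comparing
     w at consecutive points with its averages over small homothetic copies of
     the ball, gives (|A||B|)^((n-1)/n) <= C N^(n+1) I up to powers of R, where
     I = \iint_{|x-y|<4R/N} |w(x)-w(y)|.
   - Either x or y lies in {h < u < k}, or |w(x)-w(y)| = |w(x)-w(y)|^p. Hence I is
     at most a multiple of |{h<u<k}|^(1-1/p) F^(1/p), plus F. The last term costs
     N^(n+1) F ~ M N^(1-p), which is absorbed on the left for N large; then s is
     taken so close to 1 that N^(p(1-s)) <= 2. *)

Import Order.TTheory GRing.Theory Num.Theory.
Import numFieldNormedType.Exports.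

Local Open Scope classical_set_scope.
Local Open Scope ring_scope.

Set Implicit Arguments.
Unset Strict Implicit.
Unset Printing Implicit Defensive.

(** * Affine changes of variables for the iterated Lebesgue measure *)

(** Let al and be be the n-th roots of the densities of A and B in the ball. The oscillation at the
    i-th points of the segments is controlled by (N/i)^n |A| I and by (1 - i/N)^-n |B| I. Keeping
    the better bound for each i makes the sum over the chain linear in al be, whereas |A||B| is
    proportional to (al be)^n. Dividing leaves (al be)^(n-1), the origin of the exponent (n-1)/n. N
    depends on M and the gammas, but C must not. In the main term the N^(n+1) of the chain meets
    N^-n from the volume of a ball of radius 4R/N and N^-1 from the p-th root of the energy, and the
    powers cancel exactly. Only the error keeps N^(1-p), which is small because p > 1. Tonelli and
    the changes of variables are carried out for the iterated Borel measure, while u is only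
    measurable for its completion. Hence the inequality is proved for a Borel w, and u enters
    through a one-sided comparison of energies and the measures of three level sets. *)

Section ge0_le_integral_all.
Import HBNNSimple.

(** Every simple function below [f] is below [g]. The functions are arbitrary because this is later
    applied to the inner integral of the seminorm of u, taken against the completed measure. *)
Lemma ge0_le_integral_all d (T : measurableType d) (R : realType)
    (mu : {measure set T -> \bar R}) (f g : T -> \bar R) :
  (forall x, 0 <= f x)%E -> (forall x, f x <= g x)%E ->
  (\int[mu]_x f x <= \int[mu]_x g x)%E.
Proof.
move=> f0 fg; have g0 x : (0 <= g x)%E := le_trans (f0 x) (fg x).
rewrite !ge0_integralTE//; apply: ereal_sup_le => _ [h /= hf <-].
by exists h => // x; exact: le_trans (fg x).
Qed.

End ge0_le_integral_all.

Section affine_change_of_variables.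
Context (R : realType).
Local Open Scope ereal_scope.

Lemma measurable_affine (b c : R) :
  measurable_fun [set: R] (fun y : R => b + c * y)%R.
Proof. by apply: measurable_funD => //; exact: measurable_funM. Qed.

(** The image of Lebesgue measure under y -> b + c y, scaled by [c], gives each half-open interval
    its length, so it is Lebesgue measure by uniqueness. *)
Lemma integral_affine1 (b c : R) (f : measurableTypeR R -> \bar R) :
  (0 < c)%R -> measurable_fun setT f -> (forall x, 0 <= f x) ->
  c%:E * \int[@lebesgue_measure R]_y f (b + c * y)%R =
  \int[@lebesgue_measure R]_y f y.
Proof.
move=> c0 mf f0.
pose phi : measurableTypeR R -> measurableTypeR R := fun y => (b + c * y)%R.
have mphi : measurable_fun setT phi by exact: measurable_affine.
pose c' := NngNum (ltW c0).
pose nu : {measure set _ -> \bar R} :=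
  mscale c' (pushforward (@lebesgue_measure R) phi).
have E A : measurable A -> lebesgue_measure A = nu mphi A.
  apply: lebesgue_measure_unique => _ [[x y] _ <-] /=.
  rewrite /mscale /= /pushforward.
  have -> : phi @^-1` `]x, y]%classic = `]((x - b) / c)%R, ((y - b) / c)%R]%classic.
    apply/seteqP; split => z /=; rewrite /phi !in_itv /=;
      by rewrite ltr_pdivrMr// ler_pdivlMr// [(z * c)%R]mulrC ltrBlDl lerBrDl.
  rewrite !lebesgue_measure_itv/= !lte_fin.
  rewrite ltr_pM2r ?invr_gt0// ltrD2r; case: ifP => _; last by rewrite mule0.
  by rewrite -!EFinB -EFinM; congr EFin; field; rewrite gt_eqF.
rewrite [RHS](@eq_measure_integral _ _ _ _ (nu mphi))//; last by move=> A mA _; exact: E.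
rewrite ge0_integral_mscale//; congr (_ * _).
by rewrite ge0_integral_pushforward.
Qed.

Lemma borel_lebesgue_integralS n (f : n.+1.-tuple R -> \bar R) :
  measurable_fun setT f -> (forall x, 0 <= f x) ->
  \int[borel_lebesgue R n.+1]_x f x =
  \int[@lebesgue_measure R]_x \int[borel_lebesgue R n]_t f (tcons (x, t)).
Proof.
move=> mf f0.
rewrite [LHS](_ : _ =
    \int[pushforward (@lebesgue_measure R \x borel_lebesgue R n) (@tcons R n)]_x f x)//.
rewrite ge0_integral_pushforward//; last exact: measurable_tcons.
rewrite preimage_setT fubini_tonelli1//.
  by apply: measurableT_comp => //; exact: measurable_tcons.
by move=> x; exact: f0.
Qed.

Definition comb n (a : R) (x : n.-tuple R) (c : R) (y : n.-tuple R) : n.-tuple R :=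
  [tuple (a * tnth x i + c * tnth y i)%R | i < n].

Lemma measurable_comb d (X : measurableType d) n (a c : R)
    (f g : X -> n.-tuple R) : measurable_fun setT f -> measurable_fun setT g ->
  measurable_fun setT (fun x => comb a (f x) c (g x)).
Proof.
move=> mf mg; apply/measurable_fun_tnthP => i.
rewrite [X in measurable_fun _ X](_ : _ = fun x =>
  (a * tnth (f x) i + c * tnth (g x) i)%R); last first.
  by apply/funext => x /=; rewrite tnth_mktuple.
by apply: measurable_funD; apply: measurable_funM => //;
  [exact: (measurableT_comp (measurable_tnth i) mf)
  |exact: (measurableT_comp (measurable_tnth i) mg)].
Qed.

(** With [b] fixed the map is a dilation followed by a translation, of Jacobian c^n. The induction
    splits off one coordinate at a time by Tonelli. *)
Lemma integral_comb n (a c : R) (b : n.-tuple R) (f : n.-tuple R -> \bar R) :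
  (0 < c)%R -> measurable_fun setT f -> (forall x, 0 <= f x) ->
  (c ^+ n)%:E * \int[borel_lebesgue R n]_y f (comb a b c y) =
  \int[borel_lebesgue R n]_y f y.
Proof.
move=> c0; elim: n b f => [|n IH] b f mf f0.
  rewrite expr0 mul1e; apply: eq_integral => y _; congr f.
  by rewrite (tuple0 (comb _ _ _ _)) (tuple0 y).
have mfc : measurable_fun setT (fun y => f (comb a b c y)).
  by apply: measurableT_comp => //; exact: measurable_comb.
rewrite !borel_lebesgue_integralS//.
pose g (x : R) := \int[borel_lebesgue R n]_t f (tcons (x, t)).
have mft : measurable_fun setT (f \o @tcons R n).
  by apply: measurableT_comp => //; exact: measurable_tcons.
have g0 x : 0 <= g x by exact: integral_ge0.
have mg : measurable_fun [set: measurableTypeR R] g.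
  by have := measurable_fun_fubini_tonelli_F (m2 := borel_lebesgue R n) _ mft
    (fun x => f0 _).
rewrite -[RHS](integral_affine1 (a * thead b)%R c0 mg g0).
rewrite exprS EFinM -muleA; congr (_ * _).
rewrite -ge0_integralZl//; last 3 first.
- by have := measurable_fun_fubini_tonelli_F (m2 := borel_lebesgue R n) _
    (measurableT_comp mfc (@measurable_tcons R n)) (fun x => f0 _).
- by move=> x _; exact: integral_ge0.
- by rewrite lee_fin exprn_ge0// ltW.
apply: eq_integral => x _.
rewrite /g -(IH [tuple of behead b] (fun t => f (tcons ((a * thead b + c * x)%R, t))))//; last first.
  by apply: (measurableT_comp mft); exact: measurable_pair1.
congr (_ * _); apply: eq_integral => t _; congr f.
apply: eq_from_tnth => i; rewrite tnth_mktuple.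
rewrite [in LHS](tuple_eta b); case: (unliftP ord0 i) => [j|] ->.
  by rewrite !tnthS /= tnth_mktuple.
by rewrite !tnth0.
Qed.

End affine_change_of_variables.

(** * Euclidean distance on tuples *)

Section euclidean_geometry.
Context (R : realType).

Definition l2norm n (f : 'I_n -> R) : R := Num.sqrt (\sum_(i < n) f i ^+ 2).

Lemma l2norm_ge0 n (f : 'I_n -> R) : 0 <= l2norm f.
Proof. exact: sqrtr_ge0. Qed.

Lemma sqr_l2norm n (f : 'I_n -> R) : l2norm f ^+ 2 = \sum_(i < n) f i ^+ 2.
Proof. by rewrite sqr_sqrtr// sumr_ge0// => i _; exact: sqr_ge0. Qed.

Lemma l2norm_eq0 n (f : 'I_n -> R) i : l2norm f = 0 -> f i = 0.
Proof.
move=> f0; have := sqr_l2norm f; rewrite f0 expr0n/= => /esym/eqP.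
rewrite psumr_eq0; last by move=> j _; exact: sqr_ge0.
by move=> /allP/(_ i); rewrite mem_index_enum sqrf_eq0 => /(_ isT)/eqP.
Qed.

Lemma l2normZ n c (f : 'I_n -> R) : l2norm (fun i => c * f i) = `|c| * l2norm f.
Proof.
rewrite /l2norm -sqrtr_sqr -sqrtrM ?sqr_ge0//; congr Num.sqrt.
by rewrite mulr_sumr; apply: eq_bigr => i _; rewrite exprMn.
Qed.

(** With a and b the two norms, the sum of the (b f_i - a g_i)^2 equals 2ab (ab - sum f_i g_i). *)
Lemma cauchy_schwarz_l2norm n (f g : 'I_n -> R) :
  \sum_(i < n) f i * g i <= l2norm f * l2norm g.
Proof.
have [a0|a0] := eqVneq (l2norm f) 0.
  by rewrite a0 mul0r big1// => i _; rewrite (l2norm_eq0 i a0) mul0r.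
have [b0|b0] := eqVneq (l2norm g) 0.
  by rewrite b0 mulr0 big1// => i _; rewrite (l2norm_eq0 i b0) mulr0.
have a_gt0 : 0 < l2norm f by rewrite lt0r a0 l2norm_ge0.
have b_gt0 : 0 < l2norm g by rewrite lt0r b0 l2norm_ge0.
set a := l2norm f in a_gt0 *; set b := l2norm g in b_gt0 *.
have : 0 <= \sum_(i < n) (b * f i - a * g i) ^+ 2.
  by rewrite sumr_ge0// => i _; exact: sqr_ge0.
rewrite (_ : \sum_(i < n) _ = (a * b) * (a * b - \sum_(i < n) f i * g i) *+ 2).
  by rewrite pmulrn_lge0// pmulr_rge0 ?mulr_gt0// subr_ge0.
rewrite (eq_bigr (fun i => b ^+ 2 * f i ^+ 2 + (a ^+ 2 * g i ^+ 2 -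
  (a * b *+ 2) * (f i * g i)))); last by move=> i _; ring.
rewrite big_split/= sumrB -!mulr_sumr -!sqr_l2norm -/a -/b.
ring.
Qed.

Lemma ler_l2normD n (f g : 'I_n -> R) :
  l2norm (fun i => f i + g i) <= l2norm f + l2norm g.
Proof.
rewrite -ler_sqr ?nnegrE ?l2norm_ge0 ?addr_ge0 ?l2norm_ge0//.
rewrite sqrrD !sqr_l2norm.
rewrite (eq_bigr (fun i => f i ^+ 2 + (f i * g i *+ 2 + g i ^+ 2))); last first.
  by move=> i _; rewrite sqrrD; ring.
rewrite !big_split/=; have := cauchy_schwarz_l2norm f g; lra.
Qed.

(** Convertible to [euclid_dist], and [tball] below to [eball], but typed on tuples with the Borel
    sigma-algebra. The final proof passes between the two by conversion. *)
Definition l2dist n (x y : n.-tuple R) : R := l2norm (fun i => tnth x i - tnth y i).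

Definition tuple_origin n : n.-tuple R := [tuple 0 | i < n].

Definition tball n (r : R) : set (n.-tuple R) :=
  [set x | l2dist x (tuple_origin n) < r].
Arguments tball : clear implicits.

Lemma l2dist_ge0 n (x y : n.-tuple R) : 0 <= l2dist x y.
Proof. exact: l2norm_ge0. Qed.

Lemma l2distC n (x y : n.-tuple R) : l2dist x y = l2dist y x.
Proof.
rewrite /l2dist -[LHS]mul1r -[1]normrN1 -l2normZ.
by congr l2norm; apply/funext => i; rewrite mulN1r opprB.
Qed.

Lemma l2dist_triangle n (y x z : n.-tuple R) : l2dist x z <= l2dist x y + l2dist y z.
Proof.
apply: le_trans (ler_l2normD _ _).
rewrite (_ : (fun i => _) = (fun i => tnth x i - tnth z i))//.
by apply/funext => i; rewrite addrA subrK.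
Qed.

Lemma l2dist_eq0 n (x y : n.-tuple R) : l2dist x y = 0 -> x = y.
Proof.
move=> xy; apply: eq_from_tnth => i; apply/eqP; rewrite -subr_eq0; apply/eqP.
exact: (l2norm_eq0 i xy).
Qed.

Lemma l2dist_segment n (x y : n.-tuple R) c d :
  l2dist (comb (1 - c) x c y) (comb (1 - d) x d y) = `|c - d| * l2dist x y.
Proof.
rewrite l2distC /l2dist -l2normZ; congr l2norm; apply/funext => i.
by rewrite !tnth_mktuple; ring.
Qed.

Lemma comb_1_0 n (x y : n.-tuple R) : comb (1 - 0) x 0 y = x.
Proof. by apply: eq_from_tnth => i; rewrite tnth_mktuple; ring. Qed.

Lemma comb_0_1 n (x y : n.-tuple R) : comb (1 - 1) x 1 y = y.
Proof. by apply: eq_from_tnth => i; rewrite tnth_mktuple; ring. Qed.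

Lemma combC n a c (x y : n.-tuple R) : comb a x c y = comb c y a x.
Proof. by apply: eq_from_tnth => i; rewrite !tnth_mktuple addrC. Qed.

Lemma l2dist_seg0 n (x y : n.-tuple R) c :
  l2dist x (comb (1 - c) x c y) = `|c| * l2dist x y.
Proof. by rewrite -{1}(comb_1_0 x y) l2dist_segment sub0r normrN. Qed.

Lemma tball_convex n r (x y : n.-tuple R) c : 0 <= c <= 1 ->
  tball n r x -> tball n r y -> tball n r (comb (1 - c) x c y).
Proof.
move=> /andP[c0 c1]; rewrite /tball/= => xr yr.
apply: (@le_lt_trans _ _ ((1 - c) * l2dist x (tuple_origin n) +
    c * l2dist y (tuple_origin n))).
  rewrite -[X in _ <= X * _ + _]ger0_norm ?subr_ge0//.
  rewrite -[X in _ <= _ + X * _](ger0_norm c0).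
  rewrite /l2dist -!l2normZ; apply: le_trans (ler_l2normD _ _).
  rewrite le_eqVlt; apply/orP; left; apply/eqP; congr l2norm.
  by apply/funext => i; rewrite !tnth_mktuple; ring.
have [->|c10] := eqVneq c 1; first by rewrite subrr mul0r add0r mul1r.
have c1_ : 0 < 1 - c by rewrite subr_gt0 lt_neqAle c10.
nra.
Qed.

Lemma l2dist_tball n r (x y : n.-tuple R) :
  tball n r x -> tball n r y -> l2dist x y < 2 * r.
Proof.
rewrite /tball/= => xr yr; apply: le_lt_trans (l2dist_triangle (tuple_origin n) _ _) _.
by rewrite [X in _ + X]l2distC; lra.
Qed.

Lemma measurable_sqrt (D : set R) : measurable_fun D (@Num.sqrt R).
Proof.
by apply: measurable_funTS; apply: continuous_measurable_fun; exact: sqrt_continuous.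
Qed.

Lemma measurable_l2dist d (X : measurableType d) n (f g : X -> n.-tuple R) :
  measurable_fun setT f -> measurable_fun setT g ->
  measurable_fun setT (fun x => l2dist (f x) (g x)).
Proof.
move=> mf mg; apply: measurableT_comp; first exact: measurable_sqrt.
apply: measurable_sum => i; apply: measurable_funX; apply: measurable_funB.
  exact: (measurableT_comp (measurable_tnth i) mf).
exact: (measurableT_comp (measurable_tnth i) mg).
Qed.

Lemma measurable_l2dist_lt d (X : measurableType d) n r (f g : X -> n.-tuple R) :
  measurable_fun setT f -> measurable_fun setT g ->
  measurable [set x | l2dist (f x) (g x) < r].
Proof.
move=> mf mg.
have := measurable_fun_ltr (measurable_l2dist mf mg) (measurable_cst r).
by move=> /(_ measurableT [set true] Logic.I); rewrite setTI.
Qed.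

Lemma measurable_tball n r : measurable (tball n r : set (n.-tuple R)).
Proof. by apply: measurable_l2dist_lt. Qed.

End euclidean_geometry.
Arguments tball {R} n r.
Arguments tuple_origin {R} n.

(** * Volume of balls *)

Section ball_measure.
Context (R : realType).

(** Cubes have an explicit volume. Enclosing the Euclidean ball between two of them shows that its
    volume is positive and finite. *)
Definition cube n (c : R) : set (n.-tuple R) :=
  [set x | forall i, `|tnth x i| < c].

Lemma measurable_cube n (c : R) : measurable (@cube n c).
Proof.
rewrite (_ : cube _ = \bigcap_(i in setT) [set x | `|tnth x i| < c]); last first.
  by apply/seteqP; split => x /= h i; [move=> _|]; exact: h.
apply: fin_bigcap_measurable => [|i _]; first exact: finite_finset.
have := measurable_fun_ltr (measurableT_comp (@normr_measurable R setT)
  (@measurable_tnth _ R n i)) (measurable_cst c).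
by move=> /(_ measurableT [set true] Logic.I); rewrite setTI.
Qed.

Lemma borel_lebesgue_cube n (c : R) : 0 < c ->
  borel_lebesgue R n (@cube n c) = ((2 * c) ^+ n)%:E.
Proof.
move=> c0; elim: n => [|n IH].
  by rewrite expr0 /= diracE mem_set//; case.
rewrite /= /lebesgue_step /pushforward.
have -> : @tcons R n @^-1` (cube c) = `]- c, c[%classic `*` @cube n c.
  apply/seteqP; split => -[x t] /=; rewrite /cube /= in_itv /= -ltr_norml.
    by move=> h; split => [|i]; [have := h ord0|have := h (lift ord0 i)];
      rewrite ?tnth0 ?tnthS.
  move=> [h1 h2] i; case: (unliftP ord0 i) => [j|] ->; rewrite ?tnth0 ?tnthS//.
have mc := @measurable_cube n c.
rewrite product_measure1E// IH /= lebesgue_measure_itv/= lte_fin gtrN//.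
by rewrite -EFinB -EFinM exprS; congr (_ * _)%:E; ring.
Qed.

Lemma tball_sub_cube n (r : R) : tball n r `<=` @cube n r.
Proof.
move=> x; rewrite /tball/= => xr i; apply: le_lt_trans xr.
have := l2norm_ge0 (fun i => tnth x i - tnth (tuple_origin n) i).
rewrite -[X in _ <= X -> _]/(l2dist _ _) => d0.
rewrite -ler_sqr ?nnegrE// [leRHS]sqr_l2norm (bigD1 i)//= tnth_mktuple subr0.
by rewrite real_normK ?num_real// lerDl sumr_ge0// => j _; exact: sqr_ge0.
Qed.

(** The crude factor n + 1 suffices since n < (n+1)^2, in dimension 0 as well. *)
Lemma cube_sub_tball n (r : R) : 0 < r -> @cube n (r / n.+1%:R) `<=` tball n r.
Proof.
move=> r0 x xc; rewrite /tball/=.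
have n0 : 0 < n.+1%:R :> R by rewrite ltr0n.
rewrite -ltr_sqr ?nnegrE ?l2dist_ge0 ?ltW// sqr_l2norm.
apply: (@le_lt_trans _ _ (\sum_(i < n) (r / n.+1%:R) ^+ 2)).
  apply: ler_sum => i _; rewrite tnth_mktuple subr0 -real_normK ?num_real//.
  by rewrite ler_sqr ?nnegrE// ?divr_ge0 ?ltW.
rewrite sumr_const card_ord -[ltLHS]mulr_natl exprMn exprVn mulrA.
rewrite ltr_pdivrMr ?exprn_gt0// [ltLHS]mulrC ltr_pM2l ?exprn_gt0//.
by rewrite -natrX ltr_nat -mulnn leq_pmulr.
Qed.

Lemma borel_lebesgue_tball_gt0 n (r : R) : 0 < r ->
  (0 < borel_lebesgue R n (tball n r))%E.
Proof.
move=> r0; have n0 : 0 < r / n.+1%:R by rewrite divr_gt0.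
apply: (@lt_le_trans _ _ (borel_lebesgue R n (@cube n (r / n.+1%:R)))).
  by rewrite borel_lebesgue_cube// lte_fin exprn_gt0// mulr_gt0.
by apply: le_measure; rewrite ?inE; [exact: measurable_cube|
  exact: measurable_tball|exact: cube_sub_tball].
Qed.

Lemma borel_lebesgue_tball_lty n (r : R) : 0 < r ->
  (borel_lebesgue R n (tball n r) < +oo)%E.
Proof.
move=> r0; apply: (@le_lt_trans _ _ (borel_lebesgue R n (@cube n r))).
  by apply: le_measure; rewrite ?inE; [exact: measurable_tball|
    exact: measurable_cube|exact: tball_sub_cube].
by rewrite borel_lebesgue_cube// ltry.
Qed.

Definition ball_vol n : R := fine (borel_lebesgue R n (tball n 1)).

Lemma ball_vol_gt0 n : 0 < ball_vol n.
Proof.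
by rewrite fine_gt0// borel_lebesgue_tball_gt0//= borel_lebesgue_tball_lty.
Qed.

Lemma borel_lebesgue_l2ball n (x : n.-tuple R) (r : R) : 0 < r ->
  borel_lebesgue R n [set y | l2dist x y < r] = (r ^+ n * ball_vol n)%:E.
Proof.
move=> r0.
have mB : measurable [set y : n.-tuple R | l2dist x y < r].
  by apply: measurable_l2dist_lt.
have m1 : measurable_fun setT
    (EFin \o \1_[set y : n.-tuple R | l2dist x y < r] : _ -> \bar R).
  by apply/measurable_EFinP; exact: measurable_indic.
rewrite -[X in borel_lebesgue R n X]setIT -integral_indic//.
rewrite -(integral_comb 1 x r0 m1); last by move=> y; rewrite lee_fin.
rewrite (eq_integral (EFin \o \1_(tball n 1))); last first.
  move=> y _ /=; congr EFin; rewrite !indicE; congr (nat_of_bool _)%:R.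
  have E : l2dist x (comb 1 x r y) = r * l2dist y (tuple_origin n).
    rewrite l2distC -[in RHS](gtr0_norm r0) /l2dist -l2normZ; congr l2norm.
    by apply/funext => i; rewrite !tnth_mktuple; ring.
  have E' : (l2dist x (comb 1 x r y) < r) = (l2dist y (tuple_origin n) < 1).
    by rewrite E -[ltRHS]mulr1 ltr_pM2l.
  by apply/idP/idP; rewrite !inE /tball/= E'.
rewrite integral_indic ?setIT//; last exact: measurable_tball.
rewrite EFinM fineK// ge0_fin_numE//; exact: borel_lebesgue_tball_lty.
Qed.

Lemma borel_lebesgue_tball n (r : R) : 0 < r ->
  borel_lebesgue R n (tball n r) = (r ^+ n * ball_vol n)%:E.
Proof.
move=> r0; rewrite -(borel_lebesgue_l2ball (tuple_origin n) r0).
by congr (borel_lebesgue R n _); apply/seteqP; split => y; rewrite /tball/= l2distC.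
Qed.

End ball_measure.

(** * Iterated double integrals *)

Section double_integral.
Context (R : realType) (n : nat).
Notation T := (n.-tuple R).
Notation mu := (borel_lebesgue R n).
Implicit Types f g : T -> T -> \bar R.
Local Open Scope ereal_scope.

Definition dint f : \bar R := \int[mu]_x \int[mu]_y f x y.

Definition measurable2 f := measurable_fun [set: T * T] (fun z => f z.1 z.2).

Lemma measurable2_slice f x : measurable2 f -> measurable_fun setT (f x).
Proof. by move=> mf; exact: (measurable_fun_pair2 x mf). Qed.

Lemma measurable2_swap f : measurable2 f -> measurable2 (fun x y => f y x).
Proof. by move=> mf; exact: (measurableT_comp mf (@measurable_swap _ _ T T)). Qed.

Lemma measurable2_comb f a c : measurable2 f ->
  measurable2 (fun x y => f x (comb a x c y)).
Proof.
move=> mf.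
have h : measurable_fun [set: T * T] (fun z : T * T => (z.1, comb a z.1 c z.2)).
  by apply: measurable_fun_pair => //; exact: measurable_comb.
exact: (measurableT_comp mf h).
Qed.

Lemma measurable2_integral f : (forall x y, 0 <= f x y) -> measurable2 f ->
  measurable_fun setT (fun x => \int[mu]_y f x y).
Proof.
move=> f0 mf.
exact: (measurable_fun_fubini_tonelli_F (m2 := mu) _ mf (fun z => f0 _ _)).
Qed.

Lemma dint_ge0 f : (forall x y, 0 <= f x y) -> 0 <= dint f.
Proof. by move=> f0; apply: integral_ge0 => x _; exact: integral_ge0. Qed.

Lemma le_dint f g : (forall x y, 0 <= f x y) -> (forall x y, f x y <= g x y) ->
  dint f <= dint g.
Proof.
move=> f0 fg; apply: ge0_le_integral_all => x; first exact: integral_ge0.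
exact: ge0_le_integral_all.
Qed.

Lemma eq_dint f g : (forall x y, f x y = g x y) -> dint f = dint g.
Proof.
by move=> fg; apply: eq_integral => x _; apply: eq_integral => y _; exact: fg.
Qed.

Lemma dintD f g : (forall x y, 0 <= f x y) -> measurable2 f ->
  (forall x y, 0 <= g x y) -> measurable2 g ->
  dint (fun x y => f x y + g x y) = dint f + dint g.
Proof.
move=> f0 mf g0 mg; rewrite /dint -ge0_integralD//; last 4 first.
- by move=> x _; exact: integral_ge0.
- exact: measurable2_integral.
- by move=> x _; exact: integral_ge0.
- exact: measurable2_integral.
apply: eq_integral => x _; rewrite -ge0_integralD//; exact: measurable2_slice.
Qed.

Lemma dintZ (c : R) f : (0 <= c)%R -> (forall x y, 0 <= f x y) -> measurable2 f ->
  dint (fun x y => c%:E * f x y) = c%:E * dint f.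
Proof.
move=> c0 f0 mf; rewrite /dint -ge0_integralZl//; last 2 first.
- exact: measurable2_integral.
- by move=> x _; exact: integral_ge0.
by apply: eq_integral => x _; rewrite -ge0_integralZl//; exact: measurable2_slice.
Qed.

Lemma dint_sum (I : Type) (s : seq I) (f : I -> T -> T -> \bar R) :
  (forall i x y, 0 <= f i x y) -> (forall i, measurable2 (f i)) ->
  dint (fun x y => \sum_(i <- s) f i x y) = \sum_(i <- s) dint (f i).
Proof.
move=> f0 mf; rewrite /dint -ge0_integral_sum//; last 2 first.
- by move=> i; exact: measurable2_integral.
- by move=> i x _; exact: integral_ge0.
apply: eq_integral => x _; rewrite -ge0_integral_sum// => i.
exact: measurable2_slice.
Qed.

Lemma dint_swap f : (forall x y, 0 <= f x y) -> measurable2 f ->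
  dint (fun x y => f y x) = dint f.
Proof.
by move=> f0 mf; rewrite /dint -(fubini_tonelli (m1 := mu) (m2 := mu) _ mf).
Qed.

Lemma dint_comb a (c : R) f : (0 < c)%R -> (forall x y, 0 <= f x y) ->
  measurable2 f ->
  (c ^+ n)%:E * dint (fun x y => f x (comb a x c y)) = dint f.
Proof.
move=> c0 f0 mf; rewrite /dint -ge0_integralZl//; last 3 first.
- by apply: measurable2_integral => //; exact: measurable2_comb.
- by move=> x _; exact: integral_ge0.
- by rewrite lee_fin exprn_ge0// ltW.
by apply: eq_integral => x _; rewrite integral_comb//; exact: measurable2_slice.
Qed.

Lemma dint_prod (f g : T -> \bar R) : (forall x, 0 <= f x) -> (forall x, 0 <= g x) ->
  measurable_fun setT f -> measurable_fun setT g ->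
  dint (fun x y => f x * g y) = \int[mu]_x f x * \int[mu]_y g y.
Proof.
move=> f0 g0 mf mg; rewrite /dint -ge0_integralZr//; last exact: integral_ge0.
by apply: eq_integral => x _; rewrite ge0_integralZl.
Qed.

End double_integral.

(** * Dyadic decomposition of the fractional energy *)

Section dyadic_energy.
Context (R : realType).

(** With x = |a-c| and y = |b-c|, this is (x+y)^p <= 2^(p-1) (x^p + y^p), the convexity of the power
    at the midpoint of 2x and 2y. *)
Lemma powR_distD (a b c p : R) : 1 <= p ->
  `|a - b| `^ p <= 2 `^ (p - 1) * (`|a - c| `^ p + `|b - c| `^ p).
Proof.
move=> p1; have p0 : 0 < p by exact: lt_le_trans p1.
set x := `|a - c|; set y := `|b - c|.
have x0 : 0 <= x by exact: normr_ge0.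
have y0 : 0 <= y by exact: normr_ge0.
apply: (@le_trans _ _ ((x + y) `^ p)).
  apply: ge0_ler_powR; rewrite ?nnegrE ?addr_ge0//; first exact: ltW.
  by rewrite /x /y (distrC b); exact: ler_distD.
have h2 : (2 : R)^-1 <= 1 by rewrite invf_le1 ?ler1n.
have h0 : 0 <= (2 : R)^-1 by rewrite invr_ge0.
have := convex_powR p1 (Itv01 h0 h2).
move=> /(_ (2 * x) (2 * y)).
rewrite !inE/= !in_itv/= !andbT !mulr_ge0// => /(_ isT isT).
rewrite convRE [X in X `^ _ <= _ -> _]convRE/= /unstable.onem (_ : 1 - 2^-1 = 2^-1); last by lra.
rewrite !mulrA mulVf// !mul1r => /le_trans; apply.
rewrite !powRM// -!mulrDr mulrA -powR_inv1// mulrC -powRD ?pnatr_eq0 ?implybT//.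
by rewrite mulrC [(-1 + p)]addrC.
Qed.

(** Since a >= 1 the terms at least double with j, so the sum is at most twice the last one that is
    present, and that one is at most d^-a. *)
Lemma sum_dyadic_powRN (a d t : R) J : 1 <= a -> 0 < d -> 0 < t ->
  \sum_(j < J) (if d < t / 2 ^+ j then ((t / 2 ^+ j) `^ a)^-1 else 0)
    <= 2 * (d `^ a)^-1.
Proof.
move=> a1 d0 t0; pose c j : R := ((t / 2 ^+ j) `^ a)^-1.
have t_gt0 j : 0 < t / 2 ^+ j by rewrite divr_gt0 ?exprn_gt0.
have c_gt0 j : 0 < c j by rewrite invr_gt0 powR_gt0.
have cS j : 2 * c j <= c j.+1.
  rewrite /c (_ : t / 2 ^+ j.+1 = t / 2 ^+ j * 2^-1); last first.
    by rewrite exprSr invfM mulrA.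
  rewrite [in leRHS]powRM ?invr_ge0//; last exact: ltW.
  rewrite [in leRHS]invfM mulrC ler_pM2l; last exact: (c_gt0 j).
  rewrite -[leLHS]invrK lef_pV2 ?posrE ?invr_gt0 ?powR_gt0 ?invr_gt0//.
  by apply: ge1r_powR => //; rewrite invr_gt0 ltr0n invf_le1 ?ler1n.
have c_sum j : \sum_(i < j.+1) c i <= 2 * c j.
  elim: j => [|j IH]; first by rewrite big_ord1; have := c_gt0 0%N; lra.
  by rewrite big_ord_recr/=; have := cS j; lra.
elim: J => [|J IH]; first by rewrite big_ord0 mulr_ge0// invr_ge0 powR_ge0.
have [dJ|dJ] := ltP d (t / 2 ^+ J); last first.
  by rewrite big_ord_recr/= ltNge dJ/= addr0.
apply: (@le_trans _ _ (\sum_(i < J.+1) c i)).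
  by apply: ler_sum => i _; case: ifP => // _; exact/ltW/c_gt0.
apply: le_trans (c_sum J) _; rewrite ler_pM2l// lef_pV2 ?posrE ?powR_gt0//.
by rewrite ge0_ler_powR ?nnegrE ?ltW// (lt_le_trans _ a1).
Qed.

End dyadic_energy.

(** * Doubling of the energy of close pairs *)

Section nonlocal_energy.
Context (R : realType) (n : nat) (r : R) (w : n.-tuple R -> R).
Hypothesis mw : measurable_fun setT w.
Notation T := (n.-tuple R).
Notation mu := (borel_lebesgue R n).
Notation inball x := (l2dist x (tuple_origin n) < r).
Implicit Types (x y z : T) (t p a : R).

Definition close_pair t x y := [&& inball x, inball y & l2dist x y < t].

(** [dint (jump p t)] is the F(t) of the overview, and [dint (jump 1 t)] with t = 4R/N is its I. *)
Definition jump p t x y : \bar R :=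
  (if close_pair t x y then `|w x - w y| `^ p else 0)%:E.

Definition gagliardo p a x y : \bar R :=
  (if inball x && inball y then `|w x - w y| `^ p / l2dist x y `^ a else 0)%:E.

Lemma close_pairC t x y : close_pair t x y = close_pair t y x.
Proof. by rewrite /close_pair [l2dist x y]l2distC andbCA. Qed.

Lemma jump_ge0 p t x y : (0 <= jump p t x y)%E.
Proof. by rewrite lee_fin; case: ifP => // _; exact: powR_ge0. Qed.

Lemma gagliardo_ge0 p a x y : (0 <= gagliardo p a x y)%E.
Proof.
by rewrite lee_fin; case: ifP => // _; rewrite divr_ge0// powR_ge0.
Qed.

Lemma measurable_inball d (X : measurableType d) (f : X -> T) :
  measurable_fun setT f -> measurable_fun setT (fun u => inball (f u)).
Proof. by move=> mf; apply: measurable_fun_ltr => //; exact: measurable_l2dist. Qed.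

Lemma measurable_diff_powR p :
  measurable_fun setT (fun z : T * T => `|w z.1 - w z.2| `^ p).
Proof.
have h : measurable_fun setT (fun z : T * T => `|w z.1 - w z.2|).
  have h : measurable_fun setT (fun z : T * T => w z.1 - w z.2).
    by apply: measurable_funB; exact: (measurableT_comp mw).
  exact: (measurableT_comp (@normr_measurable R setT) h).
by apply: (@measurableT_comp _ _ _ _ _ _ (fun u : R => u `^ p) _
  (fun z : T * T => `|w z.1 - w z.2|)).
Qed.

Lemma measurable2_jump p t : measurable2 (jump p t).
Proof.
apply/measurable_EFinP; apply: measurable_fun_ifT => //.
  apply: measurable_and; first exact: measurable_inball.
  apply: measurable_and; first exact: measurable_inball.
  by apply: measurable_fun_ltr => //; exact: measurable_l2dist.
exact: measurable_diff_powR.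
Qed.

Lemma measurable2_gagliardo p a : measurable2 (gagliardo p a).
Proof.
apply/measurable_EFinP; apply: measurable_fun_ifT => //.
  by apply: measurable_and; exact: measurable_inball.
apply: measurable_funM; first exact: measurable_diff_powR.
rewrite (_ : (fun _ => _) = (fun z : T * T => l2dist z.1 z.2 `^ (- a))).
  have h : measurable_fun setT (fun z : T * T => l2dist z.1 z.2).
    exact: measurable_l2dist.
  by apply: (@measurableT_comp _ _ _ _ _ _ (fun u : R => u `^ (- a)) _
    (fun z : T * T => l2dist z.1 z.2)).
by apply/funext => z; rewrite powRN.
Qed.

(* The midpoint of two points of the ball lies in the ball, and y |-> (x+y)/2
   contracts Lebesgue measure by 2^-n. *)
Lemma dint_jump_double p t : 1 <= p ->
  (dint (jump p (t *+ 2)) <= (2 `^ (p + n%:R))%:E * dint (jump p t))%E.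
Proof.
move=> p1; have c0 : 0 < (2 : R)^-1 by rewrite invr_gt0.
pose m x y := comb (1 - 2^-1) x 2^-1 y.
have mC x y : m x y = m y x.
  rewrite /m combC; congr (comb _ _ _ _); lra.
have nearm x y : close_pair (t *+ 2) x y -> close_pair t x (m x y).
  move=> /and3P[xr yr xy]; apply/and3P; split => //.
    by apply: tball_convex => //; rewrite ltW//= invf_le1 ?ler1n.
  by rewrite l2dist_seg0 ger0_norm ?ltW//; lra.
have J x y : (jump p (t *+ 2) x y <= (2 `^ (p - 1))%:E *
    (jump p t x (m x y) + jump p t y (m x y)))%E.
  rewrite {1}/jump; case: ifPn => [xy|_]; last first.
    apply: mule_ge0; first by rewrite lee_fin powR_ge0.
    by apply: adde_ge0; exact: jump_ge0.
  rewrite /jump nearm// mC nearm; last by rewrite close_pairC.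
  by rewrite -EFinD -EFinM lee_fin powR_distD.
have J0 := jump_ge0 p t; have mJ := @measurable2_jump p t.
have mJ1 : measurable2 (fun x y => jump p t x (m x y)) by exact: measurable2_comb.
have mJ2 : measurable2 (fun x y => jump p t y (m x y)).
  have := measurable2_swap mJ1; congr (measurable2 _).
  by apply/funext => x; apply/funext => y; rewrite mC.
have D1 : dint (fun x y => jump p t x (m x y)) = ((2 ^+ n)%:E * dint (jump p t))%E.
  rewrite -(dint_comb (1 - 2^-1) c0 J0 mJ) muleA -EFinM -exprMn mulfV//.
  by rewrite expr1n mul1e.
have D2 : dint (fun x y => jump p t y (m x y)) = ((2 ^+ n)%:E * dint (jump p t))%E.
  rewrite -D1 -(dint_swap (fun x y => J0 x (m x y)) mJ1).
  by apply: eq_dint => x y; rewrite (mC y).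
apply: le_trans (le_dint (jump_ge0 _ _) J) _.
rewrite dintZ ?powR_ge0//; last 2 first.
- by move=> x y; rewrite adde_ge0.
- exact: emeasurable_funD.
rewrite dintD// D1 D2 -ge0_muleDl ?lee_fin ?exprn_ge0// muleA -EFinD -EFinM.
rewrite le_eqVlt; apply/orP; left; apply/eqP; congr (_%:E * _)%E.
rewrite [RHS]powRD ?pnatr_eq0 ?implybT// powR_mulrn// -(@mulr_powRB1 _ 2 p)//.
  ring.
exact: lt_le_trans p1.
Qed.

Lemma dint_jump_dyadic p t j : 1 <= p ->
  (dint (jump p t) <= ((2 `^ (p + n%:R)) ^+ j)%:E * dint (jump p (t / 2 ^+ j)))%E.
Proof.
move=> p1; elim: j => [|j IH]; first by rewrite [in leRHS]expr0 mul1e expr0 divr1.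
apply: le_trans IH _; rewrite exprSr EFinM -muleA.
apply: lee_wpmul2l; first by rewrite lee_fin exprn_ge0// powR_ge0.
rewrite (_ : t / 2 ^+ j = (t / 2 ^+ j.+1) *+ 2); first exact: dint_jump_double.
by rewrite exprSr invfM mulrA -[RHS]mulr_natr divfK.
Qed.

End nonlocal_energy.

(** * Close pairs against the Gagliardo energy *)

Section fractional_energy.
Context (R : realType) (n : nat) (r : R) (w : n.-tuple R -> R).
Hypothesis mw : measurable_fun setT w.
Notation jump := (jump r w).
Notation gagliardo := (gagliardo r w).

Lemma dint_jump_le_gagliardo p s t : (0 < n)%N -> 1 <= p -> 0 < s < 1 -> 0 < t ->
  (dint (jump p t) <= (2 `^ (p + 1) * t `^ (n%:R + s * p) * (1 - s))%:E *
    dint (gagliardo p (n%:R + s * p)))%E.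
Proof.
move=> n0 p1 /andP[s0 s1] t0; set a := n%:R + s * p.
have p0 : 0 < p by exact: lt_le_trans p1.
have a1 : 1 <= a.
  by rewrite -[1]addr0 lerD ?(ler1n _ n)// mulr_ge0// ltW.
have s1' : 0 < 1 - s by rewrite subr_gt0.
set D := dint (jump p t); set E := dint _.
pose c j : R := ((t / 2 ^+ j) `^ a)^-1.
have c0 j : 0 <= c j by rewrite invr_ge0 powR_ge0.
(* [K] makes the scales comparable: (c j) / 2^((p+n)j) is t^-a 2^(-jp(1-s)), and j (1 - s) <= 1
   bounds it below by t^-a 2^-p. *)
pose K := (2 `^ p * t `^ a)^-1.
have K0 : 0 < K by rewrite invr_gt0 mulr_gt0// powR_gt0.
(* The largest number of scales with j (1 - s) <= 1 for all j < J. As J exceeds 1/(1-s), dividing by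
   it produces the factor 1 - s. *)
pose J := (Num.truncn (1 - s)^-1).+1.
have Jlt : (1 - s)^-1 < J%:R.
  by rewrite truncnS_gt.
have cK j : (j < J)%N -> K * (2 `^ (p + n%:R)) ^+ j <= c j.
  rewrite ltnS => jJ.
  have js : j%:R * (1 - s) <= 1.
    rewrite -ler_pdivlMr// div1r; apply: le_trans (_ : J.-1%:R <= _).
      by rewrite ler_nat.
    by rewrite /= truncn_le// invr_ge0 ltW.
  rewrite /K /c invfM powRM ?invr_ge0 ?exprn_ge0//; last exact: ltW.
  rewrite [in leRHS]invfM mulrAC [leLHS]mulrC ler_pM2l ?invr_gt0 ?powR_gt0//.
  rewrite -[_ ^+ j in leLHS]powR_mulrn ?powR_ge0// -(powR_invn j)// -!powRrM -!powRN.
  rewrite -powRD ?pnatr_eq0 ?implybT// ler_powR ?ler1n// /a.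
  have := ler_wpM2r (ltW p0) js; lra.
have H : ((J%:R * K)%:E * D <= 2%:E * E)%E.
  apply: (@le_trans _ _ (\sum_(j < J) (c j)%:E * dint (jump p (t / 2 ^+ j)))%E).
    apply: (@le_trans _ _ (\sum_(j < J) K%:E * D)%E).
      rewrite -ge0_sume_distrl; last by move=> j _; rewrite lee_fin ltW.
      by rewrite sumEFin sumr_const card_ord mulr_natl.
    apply: lee_sum => j _; apply: le_trans (_ : (K * (2 `^ (p + n%:R)) ^+ j)%:E *
      dint (jump p (t / 2 ^+ j)) <= _)%E.
      rewrite EFinM -muleA lee_pmul2l ?lte_fin//; exact: dint_jump_dyadic.
    apply: lee_wpmul2r; first by apply: dint_ge0; exact: jump_ge0.
    by rewrite lee_fin cK.
  rewrite (eq_bigr (fun j : 'I_J =>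
    dint (fun x y => (c j)%:E * jump p (t / 2 ^+ j) x y)%E)); last first.
    move=> j _; rewrite dintZ//; [exact: jump_ge0|exact: measurable2_jump].
  rewrite -dint_sum; last 2 first.
  - by move=> j x y; rewrite mule_ge0 ?lee_fin//; exact: jump_ge0.
  - by move=> j; apply: measurable_funeM; exact: measurable2_jump.
  rewrite -dintZ//; last 2 first.
  - exact: gagliardo_ge0.
  - exact: measurable2_gagliardo.
  apply: le_dint => x y.
    by apply: sume_ge0 => j _; rewrite mule_ge0 ?lee_fin//; exact: jump_ge0.
  rewrite /jump /gagliardo /close_pair -EFinM.
  have [xyr|xyr] /= := boolP (_ && _); last first.
    rewrite mulr0 big1// => j _; rewrite andbA (negbTE xyr)/= mule0//.
  (* The dyadic sum bound requires a positive distance; on the diagonal both sides vanish because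
     0^p = 0. *)
  have [xy0|xy0] := eqVneq (l2dist x y) 0.
    rewrite (l2dist_eq0 xy0) subrr normr0 powR0 ?gt_eqF// mul0r mulr0.
    by rewrite big1// => j _; case: ifP => _; rewrite mule0.
  have xy_gt0 : 0 < l2dist x y by rewrite lt0r xy0 l2dist_ge0.
  rewrite (eq_bigr (fun j : 'I_J => (`|w x - w y| `^ p *
      (if l2dist x y < t / 2 ^+ j then c j else 0))%:E)); last first.
    move=> j _; move: xyr => /andP[-> ->] /=; case: ifP => _; last by rewrite mule0 mulr0.
    by rewrite -EFinM mulrC.
  rewrite sumEFin lee_fin -mulr_sumr mulrCA ler_wpM2l ?powR_ge0//.
  exact: sum_dyadic_powRN.
have JK0 : 0 < J%:R * K by rewrite mulr_gt0// ltr0n.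
have -> : D = ((J%:R * K)^-1%:E * ((J%:R * K)%:E * D))%E.
  by rewrite muleA -EFinM mulVf ?gt_eqF// mul1e.
apply: (@le_trans _ _ ((J%:R * K)^-1%:E * (2%:E * E))%E).
  by apply: lee_wpmul2l => //; rewrite lee_fin invr_ge0 ltW.
rewrite muleA -EFinM; apply: lee_wpmul2r; first by apply: dint_ge0; exact: gagliardo_ge0.
rewrite lee_fin /K invfM invrK (@powRD _ 2 p 1) ?pnatr_eq0 ?implybT// powRr1//.
have J1 : J%:R^-1 <= 1 - s.
  by rewrite -[leRHS]invrK lef_pV2 ?posrE ?invr_gt0 ?ltr0n// ltW.
have X0 : 0 <= 2 `^ p * t `^ a * 2 by rewrite !mulr_ge0 ?powR_ge0.
have := ler_wpM2l X0 J1; lra.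
Qed.

End fractional_energy.

(** * Chaining along segments *)

Section segment_chaining.
Context (R : realType) (n : nat) (r : R) (w : n.-tuple R -> R) (N : nat).
Hypotheses (mw : measurable_fun setT w) (r0 : 0 < r) (N0 : (0 < N)%N).
Notation T := (n.-tuple R).
Notation mu := (borel_lebesgue R n).
Notation jump := (jump r w).

(** Twice 2r/N: one half for the step between consecutive points, the other for the distance from a
    point to its small copy of the ball. *)
Definition mesh : R := 4 * r / N%:R.

Definition local_osc (z : T) : \bar R := (\int[mu]_q jump 1 mesh z q)%E.

Notation G := local_osc.

Lemma local_osc_ge0 z : (0 <= G z)%E.
Proof. by apply: integral_ge0 => q _; exact: jump_ge0. Qed.

Lemma measurable_local_osc : measurable_fun setT G.
Proof.
by apply: measurable2_integral; [exact: jump_ge0|exact: measurable2_jump].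
Qed.

Let N_gt0 : 0 < N%:R :> R.
Proof. by rewrite ltr0n. Qed.

(* Both z and z' are compared with the average of w over the homothetic copy
   (1 - 1/N) z + (1/N) B_r of the ball, which stays inside B_r by convexity. *)
Lemma local_osc_pair z z' : tball n r z -> tball n r z' ->
  l2dist z z' < 2 * r / N%:R ->
  (`|w z - w z'|%:E * (r ^+ n * ball_vol R n)%:E <=
   (N%:R ^+ n)%:E * (G z + G z'))%E.
Proof.
move=> zr z'r zz'.
have c0 : 0 < N%:R^-1 :> R by rewrite invr_gt0.
have c1 : 0 <= (N%:R^-1 : R) <= 1.
  by apply/andP; split; [exact: ltW|rewrite invf_le1 ?ler1n].
pose m q := comb (1 - N%:R^-1) z N%:R^-1 q.
have mj u : measurable_fun setT (jump 1 mesh u).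
  by apply: measurable2_slice; exact: measurable2_jump.
have mjm u : measurable_fun setT (fun q => jump 1 mesh u (m q)).
  by apply: (measurableT_comp (mj u)); exact: measurable_comb.
have jm u : (\int[mu]_q jump 1 mesh u (m q) = (N%:R ^+ n)%:E * G u)%E.
  rewrite /local_osc -(integral_comb (1 - N%:R^-1) z c0 (mj u)); last exact: jump_ge0.
  by rewrite muleA -EFinM exprVn mulfV ?mul1e// expf_neq0// gt_eqF.
rewrite [leRHS](ge0_muleDr _ (local_osc_ge0 z) (local_osc_ge0 z')) -(jm z) -(jm z').
rewrite -(ge0_integralD _ measurableT (fun q _ => jump_ge0 _ _ _ _ z (m q))
  (mjm z) (fun q _ => jump_ge0 _ _ _ _ z' (m q)) (mjm z')).
rewrite -borel_lebesgue_tball// -[X in mu X]setIT -integral_indic//; last first.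
  exact: measurable_tball.
rewrite -ge0_integralZl//; last first.
  by apply/measurable_EFinP; apply: measurable_indic; exact: measurable_tball.
apply: ge0_le_integral_all => q; first by rewrite mule_ge0// lee_fin.
rewrite indicE; have [|_] := boolP (q \in _); last first.
  by rewrite mule0 adde_ge0//; exact: jump_ge0.
rewrite inE => qr; rewrite mule1.
have mr : tball n r (m q) by exact: tball_convex.
have zm : l2dist z (m q) < 2 * r / N%:R.
  rewrite l2dist_seg0 gtr0_norm// mulrC ltr_pM2r//; exact: l2dist_tball.
have meshE : mesh = 2 * r / N%:R + 2 * r / N%:R.
  by rewrite /mesh -mulrDl; congr (_ / _); ring.
have m1 : l2dist z (m q) < mesh.
  by rewrite meshE; apply: lt_le_trans zm _; rewrite lerDl ltW// divr_gt0 ?mulr_gt0.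
have m2 : l2dist z' (m q) < mesh.
  apply: le_lt_trans (l2dist_triangle z _ _) _.
  by rewrite l2distC meshE ltrD.
rewrite /jump /close_pair; move: zr z'r mr; rewrite /tball/= => -> -> ->.
rewrite m1 m2/= -EFinD lee_fin !powRr1//.
by rewrite (distrC (w z')); exact: ler_distD.
Qed.

Variables A B : set T.
Hypotheses (mA : measurable A) (mB : measurable B).
Hypotheses (Ar : A `<=` tball n r) (Br : B `<=` tball n r).

Notation cr := (fun i : nat => i%:R / N%:R : R).

Definition chain_term (i : nat) : \bar R :=
  dint (fun x y => (\1_A x * \1_B y)%:E * G (comb (1 - cr i) x (cr i) y))%E.

Let measurable_indicE (S : set T) : measurable S ->
  measurable_fun setT (fun x => (\1_S x : R)%:E).
Proof. by move=> mS; apply/measurable_EFinP; exact: measurable_indic. Qed.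

Let indic2_ge0 x y : (0 <= (\1_A x * \1_B y : R)%:E)%E.
Proof. by rewrite lee_fin mulr_ge0. Qed.

Lemma measurable2_chain_term i :
  measurable2 (fun x y => (\1_A x * \1_B y)%:E * G (comb (1 - cr i) x (cr i) y))%E.
Proof.
apply: emeasurable_funM.
  apply/measurable_EFinP; apply: measurable_funM.
    by apply: (@measurableT_comp _ _ _ _ _ _ (\1_A : T -> R) _ (@fst T T));
      [exact: measurable_indic|].
  by apply: (@measurableT_comp _ _ _ _ _ _ (\1_B : T -> R) _ (@snd T T));
    [exact: measurable_indic|].
apply: (@measurableT_comp _ _ _ _ _ _ G _
  (fun z : T * T => comb (1 - cr i) z.1 (cr i) z.2)).
  exact: measurable_local_osc.
exact: measurable_comb.
Qed.

Lemma dint_indic_comb (S : set T) a c : measurable S -> 0 < c ->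
  ((c ^+ n)%:E * dint (fun x y => (\1_S x)%:E * G (comb a x c y)) =
   mu S * dint (jump 1 mesh))%E.
Proof.
move=> mS c0.
have f0 x y : (0 <= (\1_S x : R)%:E * G y)%E.
  by rewrite mule_ge0// ?lee_fin// local_osc_ge0.
have mf : measurable2 (fun x y => (\1_S x : R)%:E * G y)%E.
  apply: emeasurable_funM.
    exact: (measurableT_comp (measurable_indicE mS)).
  exact: (measurableT_comp measurable_local_osc).
rewrite (dint_comb a c0 f0 mf) dint_prod ?integral_indic ?setIT//.
- exact: local_osc_ge0.
- exact: measurable_indicE.
- exact: measurable_local_osc.
Qed.

(** For fixed x, taking the point of the segment as the new variable instead of y costs (i/N)^-n,
    once [\1_B] is bounded by 1. Keeping the factor on the left includes i = 0, where it
    vanishes. *)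
Lemma chain_term_le_left i : (0 < n)%N ->
  ((cr i ^+ n)%:E * chain_term i <= mu A * dint (jump 1 mesh))%E.
Proof.
move=> n0; have [->|i0] := posnP i.
  rewrite mul0r expr0n (gtn_eqF n0) mul0e.
  by apply: mule_ge0; [exact: measure_ge0|apply: dint_ge0; exact: jump_ge0].
have c0 : 0 < cr i by rewrite divr_gt0 ?ltr0n.
rewrite -(dint_indic_comb (1 - cr i) mA c0); apply: lee_wpmul2l.
  by rewrite lee_fin exprn_ge0// ltW.
apply: le_dint => x y; first by rewrite mule_ge0// local_osc_ge0.
apply: lee_wpmul2r; first exact: local_osc_ge0.
by rewrite lee_fin ler_piMr// indicE lern1 leq_b1.
Qed.

(** The same substitution in x for fixed y, after exchanging the integrals. It is effective near i =
    0, the previous bound near i = N. *)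
Lemma chain_term_le_right i : (0 < n)%N -> (i <= N)%N ->
  (((1 - cr i) ^+ n)%:E * chain_term i <= mu B * dint (jump 1 mesh))%E.
Proof.
move=> n0; rewrite leq_eqVlt => /predU1P[->|iN].
  rewrite (divff (lt0r_neq0 N_gt0)) subrr expr0n (gtn_eqF n0) mul0e.
  by apply: mule_ge0; [exact: measure_ge0|apply: dint_ge0; exact: jump_ge0].
have c0 : 0 < 1 - cr i by rewrite subr_gt0 ltr_pdivrMr// mul1r ltr_nat.
rewrite -(dint_indic_comb (cr i) mB c0); apply: lee_wpmul2l.
  by rewrite lee_fin exprn_ge0// ltW.
pose P x y := ((\1_A x * \1_B y)%:E * G (comb (1 - cr i) x (cr i) y))%E.
have P0 x y : (0 <= P x y)%E by rewrite mule_ge0// local_osc_ge0.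
have -> : chain_term i = dint (fun x y => P y x).
  exact/esym/(dint_swap P0 (@measurable2_chain_term i)).
apply: le_dint => x y; first by rewrite mule_ge0// local_osc_ge0.
rewrite combC; apply: lee_wpmul2r; first exact: local_osc_ge0.
by rewrite lee_fin ler_piMl// indicE lern1 leq_b1.
Qed.

Hypotheses (wA : forall x, A x -> w x = 0) (wB : forall x, B x -> w x = 1).

(** Along each segment w passes from 0 to 1, so its increments between consecutive points add up to
    at least 1 in absolute value, and [local_osc_pair] bounds each. The third factor on the left is
    the volume of the ball over which that lemma averages. *)
Lemma measure_prod_le_chain :
  (mu A * mu B * (r ^+ n * ball_vol R n)%:E <=
   (N%:R ^+ n)%:E * \sum_(i < N) (chain_term i + chain_term i.+1))%E.
Proof.
set V := r ^+ n * ball_vol R n.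
have V0 : 0 <= V by rewrite mulr_ge0 ?exprn_ge0 ?ltW// ball_vol_gt0.
pose P i x y := ((\1_A x * \1_B y)%:E * G (comb (1 - cr i) x (cr i) y))%E.
have P0 i x y : (0 <= P i x y)%E by rewrite mule_ge0// local_osc_ge0.
have mP i : measurable2 (P i) by exact: measurable2_chain_term.
have -> : (mu A * mu B * V%:E =
    dint (fun x y => V%:E * ((\1_A x)%:E * (\1_B y)%:E)))%E.
  have i0 x y : (0 <= (\1_A x : R)%:E * (\1_B y : R)%:E)%E by rewrite mule_ge0 ?lee_fin.
  have mi : measurable2 (fun x y => (\1_A x : R)%:E * (\1_B y : R)%:E)%E.
    apply: emeasurable_funM.
      exact: (measurableT_comp (measurable_indicE mA)).
    exact: (measurableT_comp (measurable_indicE mB)).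
  rewrite (dintZ V0 i0 mi).
  rewrite dint_prod ?integral_indic ?setIT//; [|exact: measurable_indicE..].
  by rewrite muleC.
have -> : ((N%:R ^+ n)%:E * \sum_(i < N) (chain_term i + chain_term i.+1) =
    dint (fun x y => (N%:R ^+ n)%:E * \sum_(i < N) (P i x y + P i.+1 x y)))%E.
  have m2 i : measurable2 (fun x y => P i x y + P i.+1 x y)%E.
    by apply: emeasurable_funD; exact: mP.
  have P20 i x y : (0 <= P i x y + P i.+1 x y)%E by exact: adde_ge0.
  rewrite dintZ; last 3 first.
  - by rewrite exprn_ge0.
  - by move=> x y; apply: sume_ge0.
  - by apply: emeasurable_sum => i; exact: m2.
  congr (_ * _)%E; rewrite (dint_sum _ (fun i : 'I_N => P20 i) (fun i : 'I_N => m2 i)).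
  by apply: eq_bigr => i _; rewrite (dintD (P0 i) (mP i) (P0 i.+1) (mP i.+1)).
apply: le_dint => x y; first by rewrite mule_ge0 ?lee_fin// -EFinM.
have [/set_mem Ax|Ax] := boolP (x \in A); last first.
  rewrite indicE (negbTE Ax) mul0e mule0 mule_ge0 ?lee_fin ?exprn_ge0//.
  by apply: sume_ge0 => i _; exact: adde_ge0.
have [/set_mem By|By] := boolP (y \in B); last first.
  rewrite [\1_B y]indicE (negbTE By) !mule0 mule_ge0 ?lee_fin ?exprn_ge0//.
  by apply: sume_ge0 => i _; exact: adde_ge0.
pose z i := comb (1 - cr i) x (cr i) y.
have PE i : P i x y = G (z i) by rewrite /P !indicE !mem_set//= mulr1 mul1e.
have zr i : (i <= N)%N -> tball n r (z i).
  move=> iN; apply: tball_convex; [|exact: Ar|exact: Br].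
  by rewrite divr_ge0//= ler_pdivrMr// mul1r ler_nat.
have step (i : 'I_N) : (`|w (z i) - w (z i.+1)|%:E * V%:E <=
    (N%:R ^+ n)%:E * (P i x y + P i.+1 x y))%E.
  rewrite !PE; apply: local_osc_pair; [exact/zr/ltnW|exact: zr|].
  rewrite l2dist_segment -mulrBl -natr1 opprD addrA subrr add0r normrM normrN1.
  rewrite mul1r ger0_norm ?invr_ge0// mulrC ltr_pM2r ?invr_gt0//.
  by apply: l2dist_tball; [exact: Ar|exact: Br].
have tel k : (k <= N)%N -> `|w (z 0%N) - w (z k)| <=
    \sum_(i < k) `|w (z i) - w (z i.+1)|.
  elim: k => [|k IH] kN; first by rewrite subrr normr0 big_ord0.
  rewrite big_ord_recr/=; apply: le_trans (ler_distD (w (z k)) _ _) _.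
  by rewrite lerD2r IH// ltnW.
rewrite !indicE !mem_set// !mule1.
have w1 : 1 <= \sum_(i < N) `|w (z i) - w (z i.+1)|.
  apply: le_trans (tel N (leqnn N)); rewrite /z mul0r comb_1_0 divff ?gt_eqF//.
  by rewrite comb_0_1 (wA Ax) (wB By) sub0r normrN normr1.
apply: (@le_trans _ _ ((\sum_(i < N) `|w (z i) - w (z i.+1)|)%:E * V%:E)%E).
  by rewrite -EFinM lee_fin ler_peMl.
rewrite -sumEFin ge0_sume_distrl; last by move=> i _; rewrite lee_fin.
rewrite ge0_sume_distrr; last by move=> i _; exact: adde_ge0.
by apply: lee_sum => i _.
Qed.

End segment_chaining.

(** * Real inequalities *)

Section real_inequalities.
Context (R : realType).

(** Telescoping: for i >= 1, y^2/(c+iy)^2 <= y/(c+(i-1)y) - y/(c+iy). The summand i = 0 is 4 y^2. *)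
Lemma sum_sqr_harmonic_le (c y : R) m : 0 < c -> 0 <= y ->
  \sum_(i < m.+1) (2 * c * y / (c + i%:R * y)) ^+ 2 <=
  4 * y ^+ 2 + 4 * c * y - 4 * c ^+ 2 * y / (c + m%:R * y).
Proof.
move=> c0 y0; have d0 j : 0 < c + j%:R * y by rewrite ltr_wpDr// mulr_ge0.
elim: m => [|m IH].
  rewrite big_ord1 mul0r addr0 le_eqVlt; apply/orP; left; apply/eqP.
  by field; rewrite gt_eqF.
rewrite big_ord_recr/=; apply: le_trans (lerD IH (lexx _)) _.
have dm := d0 m; have dm1 := d0 m.+1.
rewrite -natr1 in dm1 *; set u := c + m%:R * y in dm *.
have -> : c + (m%:R + 1) * y = u + y by rewrite /u; ring.
have uy : 0 < u + y by rewrite ltr_wpDr.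
rewrite -subr_ge0 (_ : _ - _ = (2 * c * y) ^+ 2 * y / (u * (u + y) ^+ 2)).
  by rewrite divr_ge0 ?mulr_ge0 ?sqr_ge0// ltW.
by field; rewrite !gt_eqF.
Qed.

(* With c = al N and y = 2 be, the two bounds on T i combine into
   T i <= K (2 c y / (c + i y))^n, and a square already makes this summable. *)
Lemma half_chain_term_le n N (t al be K : R) i : (2 <= n)%N -> (0 < N)%N ->
  (i * 2 <= N)%N -> 0 < al -> 0 <= be <= 1 -> 0 <= K -> 0 <= t ->
  (i%:R / N%:R) ^+ n * t <= K * al ^+ n ->
  (1 - i%:R / N%:R) ^+ n * t <= K * be ^+ n ->
  t <= K * 4 ^+ (n - 2) *
    (2 * (al * N%:R) * (2 * be) / (al * N%:R + i%:R * (2 * be))) ^+ 2.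
Proof.
move=> n2 N0 iN al0 /andP[be0 be1] K0 t0 H1 H2.
have N_gt0 : 0 < N%:R :> R by rewrite ltr0n.
set c := al * N%:R; set y := 2 * be.
have c0 : 0 < c by rewrite mulr_gt0.
have y0 : 0 <= y by rewrite mulr_ge0.
have iy0 : 0 <= i%:R * y by rewrite mulr_ge0.
have d0 : 0 < c + i%:R * y by rewrite ltr_wpDr.
have h1 : i%:R ^+ n * t <= K * c ^+ n.
  rewrite /c exprMn mulrA -ler_pdivrMr ?exprn_gt0//.
  by move: H1; rewrite expr_div_n mulrAC.
have h2 : t <= K * y ^+ n.
  rewrite /y exprMn mulrCA -ler_pdivrMl ?exprn_gt0//.
  apply: le_trans H2; apply: ler_wpM2r => //; rewrite -exprVn.
  rewrite (ler_pXn2r (ltnW n2)) ?nnegrE ?invr_ge0//; last first.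
    by rewrite subr_ge0 ler_pdivrMr// mul1r ler_nat; lia.
  rewrite lerBrDl -lerBrDr ler_pdivrMr//.
  have : (i * 2)%:R <= N%:R :> R by rewrite ler_nat.
  by rewrite natrM; lra.
set q := 2 * c * y / (c + i%:R * y).
have q0 : 0 <= q by rewrite divr_ge0 ?mulr_ge0// ltW.
(* From y <= 2 follows q <= 2y <= 4, so q^n <= 4^(n-2) q^2 at the end; this uses n >= 2. *)
have q4 : q <= 4.
  have cy : c * y <= c * 2 by rewrite ler_pM2l// /y; lra.
  by rewrite /q ler_pdivrMr//; lra.
have tq : t <= K * q ^+ n.
  rewrite /q expr_div_n mulrA ler_pdivlMr ?exprn_gt0//.
  (* If i y <= c then q >= y and [h2] suffices; otherwise q >= c / i and [h1] does. *)
  have [iyc|ciy] := leP (i%:R * y) c.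
    apply: (@le_trans _ _ (t * (2 * c) ^+ n)).
      apply: ler_wpM2l => //; apply: lerXn2r; rewrite ?nnegrE.
      - exact: ltW.
      - by rewrite mulr_ge0// ltW.
      - by lra.
    rewrite [in leRHS]exprMn [leRHS]mulrCA [leLHS]mulrC; apply: ler_wpM2l => //.
    by rewrite exprn_ge0// mulr_ge0// ltW.
  apply: (@le_trans _ _ (t * (2 * y * i%:R) ^+ n)).
    apply: ler_wpM2l => //; apply: lerXn2r; rewrite ?nnegrE.
    - exact: ltW.
    - by rewrite !mulr_ge0.
    - by lra.
  rewrite [in leLHS]exprMn mulrCA [2 * c * y]mulrAC [in leRHS]exprMn [leRHS]mulrCA.
  apply: ler_wpM2l; first by rewrite exprn_ge0// mulr_ge0.
  by rewrite mulrC.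
apply: le_trans tq _; rewrite -mulrA; apply: ler_wpM2l => //.
rewrite -{1}(subnK n2) exprD; apply: ler_wpM2r; first exact: sqr_ge0.
by apply: lerXn2r; rewrite ?nnegrE.
Qed.

(** The first half of the indices is treated by [half_chain_term_le], the second by the same lemma
    at N - i with [al] and [be] exchanged. The conditions 2 be <= al N and 2 al <= be N say that y
    <= c in the two cases, so the summand 4 y^2 of the harmonic sum is absorbed into 4 c y. *)
Lemma chain_sum_le n N (T : nat -> R) (al be K : R) : (2 <= n)%N -> (0 < N)%N ->
  0 < al <= 1 -> 0 < be <= 1 -> 0 <= K ->
  2 * be <= al * N%:R -> 2 * al <= be * N%:R ->
  (forall i, 0 <= T i) ->
  (forall i, (i <= N)%N -> (i%:R / N%:R) ^+ n * T i <= K * al ^+ n) ->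
  (forall i, (i <= N)%N -> (1 - i%:R / N%:R) ^+ n * T i <= K * be ^+ n) ->
  \sum_(i < N) (T i + T i.+1) <= 4 ^+ n.+1 * (al * be * N%:R * K).
Proof.
move=> n2 N0 /andP[al0 al1] /andP[be0 be1] K0 bal alb T0 H1 H2.
have N_gt0 : 0 < N%:R :> R by rewrite ltr0n.
pose f a b i : R := K * 4 ^+ (n - 2) *
    (2 * (a * N%:R) * (2 * b) / (a * N%:R + i%:R * (2 * b))) ^+ 2.
have f0 a b i : 0 <= f a b i by rewrite mulr_ge0 ?sqr_ge0// mulr_ge0// exprn_ge0.
have Tf (i : 'I_N.+1) : T i <= f al be i + f be al (N - i)%N.
  have iN : (i <= N)%N by rewrite -ltnS.
  have [i2|i2] := leqP (i * 2) N.
    apply: ler_wpDr => //; apply: half_chain_term_le => //; rewrite ?(ltW be0)//.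
    - exact: H1.
    - exact: H2.
  have E : (N - i)%:R / N%:R = 1 - i%:R / N%:R :> R.
    by rewrite natrB// mulrBl divff// gt_eqF.
  apply: ler_wpDl => //; apply: half_chain_term_le => //; rewrite ?(ltW al0)//.
  - lia.
  - by rewrite E; exact: H2.
  - by rewrite E opprB addrCA subrr addr0; exact: H1.
have fS a b : 0 < a -> 0 <= b -> 2 * b <= a * N%:R ->
    \sum_(i < N.+1) f a b i <= 4 ^+ n * (a * b * N%:R * K).
  move=> a0 b0 ba; rewrite -mulr_sumr.
  have c0 : 0 < a * N%:R by rewrite mulr_gt0.
  have S := sum_sqr_harmonic_le N c0 (mulr_ge0 (ltW (ltr0Sn R 1)) b0).
  apply: (@le_trans _ _ (K * 4 ^+ (n - 2) * (8 * (a * N%:R) * (2 * b)))).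
    apply: ler_wpM2l; first by rewrite mulr_ge0// exprn_ge0.
    apply: le_trans S _.
    have : 0 <= 4 * (a * N%:R) ^+ 2 * (2 * b) / (a * N%:R + N%:R * (2 * b)).
      by rewrite divr_ge0// ?addr_ge0 ?mulr_ge0 ?sqr_ge0// ltW.
    by nra.
  rewrite le_eqVlt; apply/orP; left; apply/eqP.
  rewrite -{2}(subnK n2) exprD; ring.
apply: (@le_trans _ _ (2 * \sum_(i < N.+1) T i)).
  rewrite big_split/= mulr_natl mulr2n lerD//.
    by rewrite big_ord_recr/= lerDl.
  by rewrite big_ord_recl/= lerDr.
rewrite [leRHS](_ : _ = 2 * (2 * (4 ^+ n * (al * be * N%:R * K)))); last first.
  by rewrite exprS; ring.
rewrite ler_pM2l//.
apply: (@le_trans _ _ (\sum_(i < N.+1) (f al be i + f be al (N - i)%N))).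
  by apply: ler_sum => i _.
rewrite big_split/= mulr_natl mulr2n lerD//.
  exact: fS al0 (ltW be0) bal.
rewrite (reindex_inj rev_ord_inj)/= (eq_bigr (fun i : 'I_N.+1 => f be al i)).
  by have := fS be al be0 (ltW al0) alb; rewrite (mulrC be) !mulrA.
by move=> i _; rewrite subSS subKn// -ltnS.
Qed.

(** The choice l = (F/P)^(1/p) makes both terms equal. If P or F is 0, a suitable l would make the
    right side smaller than a positive X. *)
Lemma young_optimize (X P F p : R) : 1 < p -> 0 <= P -> 0 <= F ->
  (forall l, 0 < l -> X <= l * P + l `^ (1 - p) * F) ->
  X <= 2 * (P `^ ((p - 1) / p) * F `^ p^-1).
Proof.
move=> p1 P0 F0 H; have p0 : 0 < p by exact: lt_trans p1.
have [X0|X0] := leP X 0; first by apply: le_trans X0 _; rewrite !mulr_ge0 ?powR_ge0.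
move: P0; rewrite le_eqVlt => /predU1P[P0|P0].
  exfalso; pose l := (X / (2 * (F + 1))) `^ (1 - p)^-1.
  have l0 : 0 < X / (2 * (F + 1)) by rewrite divr_gt0// mulr_gt0// ltr_wpDl.
  have := H l (powR_gt0 _ l0).
  rewrite -P0 mulr0 add0r /l -powRrM mulVf; last by rewrite subr_eq0 lt_eqF.
  rewrite (powRr1 (ltW l0)).
  rewrite leNgt => /negP; apply; rewrite mulrAC ltr_pdivrMr ?mulr_gt0// ?ltr_wpDl//.
  by nra.
move: F0; rewrite le_eqVlt => /predU1P[F0|F0].
  exfalso; have l0 : 0 < X / (2 * P) by rewrite divr_gt0// mulr_gt0.
  have := H _ l0; rewrite -F0 mulr0 addr0 (_ : X / (2 * P) * P = X / 2); first by lra.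
  by field; rewrite gt_eqF.
pose l := (F / P) `^ p^-1.
have l0 : 0 < l by rewrite powR_gt0// divr_gt0.
apply: le_trans (H l l0) _; rewrite mulr_natl mulr2n.
have lP : l * P = P `^ ((p - 1) / p) * F `^ p^-1.
  have PE : P = P `^ ((p - 1) / p) * P `^ p^-1.
    rewrite -powRD; last by rewrite (gt_eqF P0) implybT.
    rewrite (_ : _ / p + _ = 1) ?(powRr1 (ltW P0))//.
    by field; rewrite gt_eqF.
  rewrite {1}PE /l mulrCA -powRM ?(ltW P0)//; last by rewrite divr_ge0 ?(ltW P0) ?(ltW F0).
  by rewrite divfK// gt_eqF.
have lF : l `^ (1 - p) * F = l * P.
  have lp : l `^ p = F / P.
    rewrite /l -powRrM mulVf ?gt_eqF// powRr1// divr_ge0 ?(ltW P0) ?(ltW F0)//.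
  rewrite powRD; last by rewrite (gt_eqF l0) implybT.
  rewrite powRr1 ?(ltW l0)// powRN lp.
  by field; rewrite !gt_eqF.
by rewrite lF lP.
Qed.

(** From N <= 2^N one gets N^(1/N) <= 2. *)
Lemma powR_le2 (N : nat) (x : R) : (0 < N)%N -> x <= N%:R^-1 -> N%:R `^ x <= 2.
Proof.
move=> N0 xN; have N_gt0 : 0 < N%:R :> R by rewrite ltr0n.
apply: (@le_trans _ _ (N%:R `^ N%:R^-1)); first by rewrite ler_powR// ler1n.
apply: (@le_trans _ _ ((2 `^ N%:R) `^ N%:R^-1)).
  apply: ge0_ler_powR; rewrite ?nnegrE ?invr_ge0 ?powR_ge0//.
  by rewrite powR_mulrn// -natrX ler_nat ltnW// ltn_expl.
by rewrite -powRrM mulfV ?gt_eqF// powRr1.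
Qed.

End real_inequalities.

(** * Constants and the inequality between real numbers *)

Section isoperimetric_constants.
Context (R : realType).

(** At t = 4r/N the constant 2^(p+1) of the energy estimate acquires 4^n and 4^(sp) <= 4^p; the last
    2 bounds N^(p(1-s)). *)
Definition energy_const n (p : R) : R := 2 `^ (p + 1) * 4 ^+ n * 4 `^ p * 2.

(** [om] is the volume of the unit ball. In 4^(n+2), one 4 combines the 2 of Young's inequality and
    the 2 of the absorption. The base 2 4^n om is the volume factor in front of the measure of the
    transition region. *)
Definition iso_const n (p om : R) : R :=
  4 ^+ n.+2 * om ^- 2 * (om ^+ 2) `^ ((n%:R - 1) / n%:R) *
  (2 * 4 ^+ n * om) `^ ((p - 1) / p) * energy_const n p `^ p^-1.

Lemma energy_const_gt0 n p : 0 < energy_const n p.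
Proof. by rewrite !mulr_gt0// ?powR_gt0// exprn_gt0. Qed.

Lemma iso_const_gt0 n p om : 0 < om -> 0 < iso_const n p om.
Proof.
move=> om0; have d0 : 0 < 2 * 4 ^+ n * om by rewrite !mulr_gt0// exprn_gt0.
rewrite /iso_const; move: (energy_const_gt0 n p) => c0.
apply: mulr_gt0; last exact: powR_gt0.
apply: mulr_gt0; last exact: powR_gt0.
apply: mulr_gt0; last by rewrite powR_gt0// exprn_gt0.
by apply: mulr_gt0; rewrite ?invr_gt0 exprn_gt0.
Qed.

(* At scale t = 4 r / N the dimensional factor N^-(s p) is comparable to N^-p
   as soon as p (1 - s) <= 1 / N. *)
Lemma jump_energy_scale n (p s r E F : R) N : (0 < N)%N -> 1 < p -> 0 < s < 1 ->
  0 < r -> 0 <= E -> p * (1 - s) <= N%:R^-1 ->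
  F <= 2 `^ (p + 1) * (4 * r / N%:R) `^ (n%:R + s * p) * (1 - s) * E ->
  F <= (r / N%:R) ^+ n *
    ((energy_const n p * (r `^ (s * p) * ((1 - s) * E))) * N%:R `^ (- p)).
Proof.
move=> N0 p1 /andP[s0 s1] r0 E0 ps hF; apply: le_trans hF _.
have N_gt0 : 0 < N%:R :> R by rewrite ltr0n.
have p0 : 0 < p by exact: lt_trans p1.
have t0 : 0 < 4 * r / N%:R by rewrite divr_gt0// mulr_gt0.
rewrite (@powRD _ (4 * r / N%:R)); last by rewrite (gt_eqF t0) implybT.
rewrite (powR_mulrn _ (ltW t0)).
have -> : 4 * r / N%:R = 4 * (r / N%:R) by rewrite mulrA.
have rN0 : 0 <= r / N%:R by rewrite divr_ge0 ?ltW.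
rewrite [in X in _ * (X * _)]exprMn (powRM _ _ rN0)//.
have -> : (r / N%:R) `^ (s * p) = r `^ (s * p) * N%:R `^ (- (s * p)).
  by rewrite powRM ?invr_ge0 ?(ltW r0)// -powR_inv1// -powRrM mulN1r.
have h4 : 4 `^ (s * p) <= 4 `^ p :> R.
  by rewrite ler_powR ?ler1n// ler_piMl ?(ltW p0) ?(ltW s1).
have hN : N%:R `^ (- (s * p)) <= N%:R `^ (- p) * 2 :> R.
  have -> : - (s * p) = - p + p * (1 - s) by ring.
  rewrite (@powRD _ N%:R); last by rewrite (gt_eqF N_gt0) implybT.
  by apply: ler_wpM2l; rewrite ?powR_ge0// powR_le2.
have e0 : 0 <= (1 - s) * E by rewrite mulr_ge0// subr_ge0 ltW.
have h : 4 `^ (s * p) * N%:R `^ (- (s * p)) <= 4 `^ p * (N%:R `^ (- p) * 2) :> R.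
  by apply: ler_pM; rewrite ?powR_ge0.
have Z0 : 0 <= 2 `^ (p + 1) * 4 ^+ n * (r / N%:R) ^+ n * r `^ (s * p) * ((1 - s) * E).
  by apply: mulr_ge0 => //; rewrite !mulr_ge0 ?powR_ge0 ?exprn_ge0.
have := ler_wpM2l Z0 h; rewrite /energy_const.
set Y := (r / N%:R) ^+ n; set a1 := 2 `^ _; set a2 := r `^ _; set a3 := 4 `^ _.
set a4 := N%:R `^ _; set a5 := 4 `^ _; set a6 := N%:R `^ _; set a7 := 4 ^+ n.
move=> H; apply: le_trans (le_trans H _); rewrite le_eqVlt; apply/orP; left;
  apply/eqP; ring.
Qed.

(** The estimates enter as hypotheses on real numbers: [A], [B], [D] are the measures of the two
    level sets and of the transition region, [E] is the Gagliardo energy, [I] and [F] are the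
    integrals of [jump 1] and [jump p] at t = 4r/N, and [T] lists the chain terms. *)
Lemma isoperimetric_assembly n (p M g1 g2 s r om A B D E I F : R) N
    (T : nat -> R) (V := r ^+ n * om) :
  (2 <= n)%N -> (0 < N)%N -> 1 < p -> 0 < s < 1 -> 0 < r -> 0 < om ->
  0 < g1 -> 0 < g2 ->
  g1 * V <= A <= V -> g2 * V <= B <= V -> 0 <= D -> 0 <= E -> 0 <= I ->
  F <= 2 `^ (p + 1) * (4 * r / N%:R) `^ (n%:R + s * p) * (1 - s) * E ->
  (forall l, 0 < l ->
    I <= l * (2 * ((4 * r / N%:R) ^+ n * om)) * D + (l `^ (1 - p) + 1) * F) ->
  A * B * V <= N%:R ^+ n * (\sum_(i < N) (T i + T i.+1)) ->
  (forall i, 0 <= T i) ->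
  (forall i, (i <= N)%N -> (i%:R / N%:R) ^+ n * T i <= A * I) ->
  (forall i, (i <= N)%N -> (1 - i%:R / N%:R) ^+ n * T i <= B * I) ->
  (1 - s) * r `^ (s * p) * E <= M * r ^+ n ->
  2 <= g1 * N%:R -> 2 <= g2 * N%:R ->
  4 ^+ n.+1 * energy_const n p * M / om ^+ 2 * N%:R `^ (1 - p) <= g1 * g2 / 2 ->
  p * (1 - s) <= N%:R^-1 ->
  (A * B) `^ ((n%:R - 1) / n%:R) <=
    iso_const n p om * r `^ (n%:R - 2 + s) * (1 - s) `^ p^-1 *
    (E `^ p^-1 * D `^ ((p - 1) / p)).
Proof.
have VE : V = r ^+ n * om by []; clearbody V.
move=> n2 N0 p1 s01 r0 om0 g10 g20 /andP[gA AV] /andP[gB BV] D0 E0 I0 hF hI hT T0.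
move=> hTA hTB hM gN1 gN2 hN hs.
have p0 : 0 < p by exact: lt_trans p1.
have /andP[s0 s1] := s01.
have n0 : (0 < n)%N by exact: ltnW.
have nR0 : 0 < n%:R :> R by rewrite ltr0n.
have N_gt0 : 0 < N%:R :> R by rewrite ltr0n.
have V0 : 0 < V by rewrite VE mulr_gt0// exprn_gt0.
(* Ratio of the linear sizes of a set of volume [X] and of the ball; [al] and [be] below are its
   values at [A] and [B]. *)
pose root (X : R) := (X / V) `^ n%:R^-1.
have rootX X : 0 <= X -> root X ^+ n = X / V.
  move=> X0; rewrite -powR_mulrn ?powR_ge0// /root -powRrM mulVf ?gt_eqF//.
  by rewrite powRr1// divr_ge0// ltW.
have root_le1 X : 0 <= X -> X <= V -> root X <= 1.
  move=> X0 XV; apply: (@le_trans _ _ (1 `^ n%:R^-1)); last by rewrite powR1.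
  apply: ge0_ler_powR.
  - by rewrite invr_ge0 ltW.
  - by rewrite nnegrE divr_ge0// ltW.
  - by rewrite nnegrE.
  - by rewrite ler_pdivrMr// mul1r.
have root_ge X g : 0 < g -> g * V <= X -> X <= V -> g <= root X.
  move=> g0 gX XV; have X0 : 0 < X by apply: lt_le_trans gX; rewrite mulr_gt0.
  have rx0 : 0 <= root X by exact: powR_ge0.
  have : g <= root X ^+ n by rewrite rootX ?(ltW X0)// ler_pdivlMr.
  move=> /le_trans; apply; rewrite -[leRHS]expr1; apply: ler_wiXn2l => //.
  by apply: root_le1 => //; exact: ltW.
have A0 : 0 < A by apply: lt_le_trans gA; rewrite mulr_gt0.
have B0 : 0 < B by apply: lt_le_trans gB; rewrite mulr_gt0.
set al := root A; set be := root B.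
have gal : g1 <= al by exact: root_ge.
have gbe : g2 <= be by exact: root_ge.
have al0 : 0 < al by exact: lt_le_trans gal.
have be0 : 0 < be by exact: lt_le_trans gbe.
have al1 : al <= 1 by apply: root_le1 => //; exact: ltW.
have be1 : be <= 1 by apply: root_le1 => //; exact: ltW.
have AE : A = V * al ^+ n by rewrite rootX ?(ltW A0)// mulrC divfK// gt_eqF.
have BE : B = V * be ^+ n by rewrite rootX ?(ltW B0)// mulrC divfK// gt_eqF.
have S : \sum_(i < N) (T i + T i.+1) <= 4 ^+ n.+1 * (al * be * N%:R * (V * I)).
  apply: chain_sum_le => //; rewrite ?al0 ?be0//.
  - by rewrite mulr_ge0// ltW.
  - apply: (@le_trans _ _ 2); first by rewrite ler_piMr.
    by apply: le_trans gN1 _; rewrite ler_pM2r.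
  - apply: (@le_trans _ _ 2); first by rewrite ler_piMr.
    by apply: le_trans gN2 _; rewrite ler_pM2r.
  - by move=> i iN; rewrite mulrAC -AE; exact: hTA.
  - by move=> i iN; rewrite mulrAC -BE; exact: hTB.
have [m nE] : exists m, n = m.+1 by exists n.-1; rewrite prednK.
pose q := (al * be) ^+ m.
have q0 : 0 < q by rewrite exprn_gt0// mulr_gt0.
(* This lower bound is what permits the absorption in [H3]. As al be <= 1, lowering the exponent
   from n to n - 1 only increases the power. *)
have gq : g1 * g2 <= q.
  have ga : g1 <= al ^+ n by rewrite rootX ?(ltW A0)// ler_pdivlMr.
  have gb : g2 <= be ^+ n by rewrite rootX ?(ltW B0)// ler_pdivlMr.
  apply: (@le_trans _ _ (al ^+ n * be ^+ n)).
    by apply: ler_pM => //; exact: ltW.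
  rewrite -exprMn nE exprS -/q ler_piMl ?(ltW q0)//.
  by rewrite mulr_ile1 ?(ltW al0) ?(ltW be0).
have ABV : A * B = V ^+ 2 * (al * be) ^+ n.
  rewrite AE BE [(al * be) ^+ n]exprMn.
  by move: (al ^+ n) (be ^+ n) => u v; ring.
(* The left side of [hT] is V^3 (al be)^n and its right side carries V al be; cancelling leaves the
   power n - 1. *)
have H1 : q * V ^+ 2 <= 4 ^+ n.+1 * N%:R ^+ n.+1 * I.
  have Z0 : 0 < V * (al * be) by rewrite mulr_gt0// mulr_gt0.
  rewrite -(ler_pM2l Z0).
  have h := le_trans hT (ler_wpM2l (exprn_ge0 n (ltW N_gt0)) S).
  have -> : V * (al * be) * (q * V ^+ 2) = A * B * V.
    by rewrite ABV nE [(al * be) ^+ _]exprS -/q; ring.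
  apply: le_trans h _; rewrite le_eqVlt; apply/orP; left; apply/eqP.
  by rewrite (exprS N%:R); set u := _ ^+ n; set v := _ ^+ n.+1; ring.
pose xp := energy_const n p * (r `^ (s * p) * ((1 - s) * E)).
pose x := xp `^ p^-1.
pose Y := (r / N%:R) ^+ n.
pose Z := xp * N%:R `^ (- p).
pose Dc := 2 * 4 ^+ n * om * D.
pose b := (p - 1) / p.
have e0 : 0 <= (1 - s) * E by rewrite mulr_ge0// subr_ge0 ltW.
have ec0 := ltW (energy_const_gt0 n p).
have xp0 : 0 <= xp by rewrite mulr_ge0// mulr_ge0// powR_ge0.
have Z0 : 0 <= Z by rewrite mulr_ge0// powR_ge0.
have Y0 : 0 < Y by rewrite exprn_gt0// divr_gt0.
have Dc0 : 0 <= Dc by rewrite !mulr_ge0 ?exprn_ge0// ltW.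
have FZ : F <= Y * Z by exact: jump_energy_scale.
(* [Y] factors out of both terms of [hI]; the summand of [F] without l becomes [Z] and is moved to
   the left before optimizing in l. *)
have IX : I / Y - Z <= 2 * (Dc `^ b * Z `^ p^-1).
  apply: young_optimize => // l l0; rewrite lerBlDr ler_pdivrMr//.
  apply: le_trans (hI l l0) _.
  have l1 : 0 <= l `^ (1 - p) + 1 by rewrite addr_ge0// powR_ge0.
  have := ler_wpM2l l1 FZ.
  have -> : (4 * r / N%:R) ^+ n = 4 ^+ n * Y by rewrite -mulrA exprMn.
  rewrite /Dc; set u := l `^ _; set v := 4 ^+ n; lra.
have Zx : Z `^ p^-1 = x / N%:R.
  rewrite /Z powRM ?powR_ge0// -powRrM mulNr mulfV ?gt_eqF//.
  by rewrite powR_inv1// ltW.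
(* One N remains: it cancels the 1/N of [Zx] in the main term and turns N^-p into N^(1-p) in the
   error. *)
have NY : N%:R ^+ n.+1 * Y = N%:R * r ^+ n.
  by rewrite exprS -mulrA -exprMn [_ * (r / _)]mulrC divfK ?gt_eqF.
have H2 : q * (r ^+ n * om ^+ 2) <=
    4 ^+ n.+1 * (2 * (Dc `^ b * x) + xp * N%:R `^ (1 - p)).
  have rn0 : 0 < r ^+ n by rewrite exprn_gt0.
  rewrite -(ler_pM2l rn0).
  have -> : r ^+ n * (q * (r ^+ n * om ^+ 2)) = q * V ^+ 2 by rewrite VE; ring.
  apply: le_trans H1 _.
  move: IX; rewrite lerBlDr ler_pdivrMr// Zx => IX.
  apply: (@le_trans _ _ (4 ^+ n.+1 * N%:R ^+ n.+1 *
      ((2 * (Dc `^ b * (x / N%:R)) + Z) * Y))).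
    by apply: ler_wpM2l => //; rewrite mulr_ge0// exprn_ge0// ltW.
  have -> : 4 ^+ n.+1 * N%:R ^+ n.+1 * ((2 * (Dc `^ b * (x / N%:R)) + Z) * Y) =
      4 ^+ n.+1 * (N%:R ^+ n.+1 * Y) * (2 * (Dc `^ b * (x / N%:R)) + Z).
    by set u := 4 ^+ _; set v := N%:R ^+ _; ring.
  rewrite NY /Z.
  have -> : N%:R `^ (1 - p) = N%:R * N%:R `^ (- p).
    rewrite powRD ?powRr1 ?(ltW N_gt0)//.
    by rewrite (gt_eqF N_gt0) implybT.
  set u := 4 ^+ _; set v := r ^+ n; set w := Dc `^ b; set z := N%:R `^ _.
  rewrite le_eqVlt; apply/orP; left; apply/eqP.
  by field; rewrite gt_eqF.
(* By [hM] the energy in [xp] is at most M r^n, and N was chosen so that the error is at most half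
   of the left side of [H2]. *)
have H3 : 4 ^+ n.+1 * (xp * N%:R `^ (1 - p)) <= q / 2 * (r ^+ n * om ^+ 2).
  have om2 : 0 < om ^+ 2 by rewrite exprn_gt0.
  have rn0 : 0 <= r ^+ n by rewrite exprn_ge0// ltW.
  have := ler_wpM2r rn0 (ler_wpM2r (ltW om2) (le_trans hN (ler_wpM2r _ gq))).
  rewrite invr_ge0 ler0n => /(_ isT).
  rewrite -[X in _ <= X -> _]mulrA [om ^+ 2 * _]mulrC; apply: le_trans.
  have -> : 4 ^+ n.+1 * energy_const n p * M / om ^+ 2 * N%:R `^ (1 - p) * om ^+ 2 * r ^+ n =
      4 ^+ n.+1 * N%:R `^ (1 - p) * (energy_const n p * (M * r ^+ n)).
    set u := 4 ^+ _; set v := N%:R `^ _; set w := r ^+ n; set z := energy_const _ _.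
    by field; rewrite gt_eqF.
  rewrite [xp * _]mulrC [leLHS]mulrA; apply: ler_wpM2l.
    by rewrite mulr_ge0 ?powR_ge0// exprn_ge0.
  rewrite /xp; apply: ler_wpM2l => //.
  by move: hM; rewrite mulrCA mulrA.
have H4 : q <= 4 ^+ n.+2 * (Dc `^ b * x) / (r ^+ n * om ^+ 2).
  rewrite ler_pdivlMr; last by rewrite mulr_gt0// exprn_gt0.
  rewrite (exprS _ n.+1); move: H2 H3.
  set u := 4 ^+ _; set v := r ^+ n * _; set w := Dc `^ b * x; set z := xp * _.
  by lra.
pose b' : R := (n%:R - 1) / n%:R.
have alben : ((al * be) ^+ n) `^ b' = q.
  have ab0 : 0 <= al * be by rewrite mulr_ge0// ltW.
  rewrite -(powR_mulrn n ab0) -powRrM /b' [n%:R * _]mulrC divfK ?gt_eqF//.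
  by rewrite /q -powR_mulrn// nE -natr1 addrK.
have Vb : (V ^+ 2) `^ b' = (om ^+ 2) `^ b' * r `^ (2 * (n%:R - 1)).
  rewrite VE exprMn powRM ?sqr_ge0//; rewrite mulrC; congr (_ * _).
  rewrite -exprM -powR_mulrn ?(ltW r0)// -powRrM natrM /b'; congr (_ `^ _).
  by field; rewrite gt_eqF.
rewrite ABV -/b' powRM ?sqr_ge0 ?exprn_ge0 ?mulr_ge0 ?(ltW al0) ?(ltW be0)//.
rewrite alben Vb.
have c0 : 0 <= (om ^+ 2) `^ b' * r `^ (2 * (n%:R - 1)) by rewrite mulr_ge0 ?powR_ge0.
apply: le_trans (ler_wpM2l c0 H4) _.
have xE : x = energy_const n p `^ p^-1 * (r `^ s * ((1 - s) `^ p^-1 * E `^ p^-1)).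
  have re0 : 0 <= r `^ (s * p) * ((1 - s) * E) by rewrite mulr_ge0// powR_ge0.
  rewrite /x /xp (powRM _ ec0 re0) (powRM _ (powR_ge0 _ _) e0) -[in LHS]powRrM.
  rewrite mulfK ?gt_eqF// (powRM _ _ E0)// subr_ge0.
  exact: ltW.
have DcE : Dc `^ b = (2 * 4 ^+ n * om) `^ b * D `^ b.
  have d0 : 0 <= 2 * 4 ^+ n * om by apply: mulr_ge0; [rewrite mulr_ge0// exprn_ge0|exact: ltW].
  by rewrite /Dc (powRM _ d0 D0).
(* 2(n-1) comes from V^2 raised to (n-1)/n, -n from dividing by r^n in [H4], and s from the p-th
   root of r^(sp). *)
have rE : r `^ (2 * (n%:R - 1)) / r ^+ n * r `^ s = r `^ (n%:R - 2 + s).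
  rewrite -powR_mulrn ?(ltW r0)// -powRN -!powRD ?(gt_eqF r0) ?implybT//.
  by congr (_ `^ _); ring.
rewrite xE DcE -rE /iso_const -/b -/b'.
set u1 := (om ^+ 2) `^ _; set u2 := r `^ _; set u3 := 4 ^+ _; set u4 := _ `^ b.
set u5 := D `^ b; set u6 := energy_const _ _ `^ _; set u7 := r `^ s.
set u8 := _ `^ p^-1; set u9 := E `^ _; set v := r ^+ n.
rewrite le_eqVlt; apply/orP; left; apply/eqP.
by field; rewrite !gt_eqF// exprn_gt0.
Qed.

End isoperimetric_constants.

(** * The inequality for Borel functions *)

Section transition_region.
Context (R : realType) (n : nat) (r : R) (w : n.-tuple R -> R).
Hypotheses (mw : measurable_fun setT w) (w01 : forall x, 0 <= w x <= 1).
Notation T := (n.-tuple R).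
Notation mu := (borel_lebesgue R n).
Notation jump := (jump r w).
Notation gagliardo := (gagliardo r w).

Definition transition : set T := tball n r `&` [set x | 0 < w x < 1].

Lemma measurable_level (P : R -> bool) : measurable [set x : R | P x] ->
  measurable (tball n r `&` [set x | P (w x)]).
Proof.
move=> mP; apply: measurableI; first exact: measurable_tball.
by have := mw measurableT mP; rewrite setTI.
Qed.

Lemma measurable_transition : measurable transition.
Proof.
apply: (@measurable_level (fun u => 0 < u < 1)).
rewrite (_ : [set _ | _] = `]0, 1[%classic)//.
Qed.

(* Either one of the two points lies in the transition region, where d is split
   as l + l^(1-p) d^p, or d is 0 or 1 and thus equal to d^p. *)
Lemma jump_le_split p l t x y : 1 < p -> 0 < l ->
  (jump 1 t x y <= l%:E * ((\1_transition x)%:E * (\1_[set z | l2dist x z < t] y)%:E +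
      (\1_transition y)%:E * (\1_[set z | l2dist y z < t] x)%:E) +
    (l `^ (1 - p) + 1)%:E * jump p t x y)%E.
Proof.
move=> p1 l0; have p0 : 0 < p by exact: lt_trans p1.
have lp0 : 0 <= l `^ (1 - p) by exact: powR_ge0.
rewrite /jump; case: ifPn => [/and3P[xr yr xy]|_]; last first.
  rewrite mule0 adde0; apply: mule_ge0; first by rewrite lee_fin ltW.
  by apply: adde_ge0; apply: mule_ge0; rewrite lee_fin.
rewrite powRr1//; set d := `|w x - w y|.
have d0 : 0 <= d by exact: normr_ge0.
have -> : \1_[set z | l2dist x z < t] y = 1 :> R by rewrite indicE mem_set.
have -> : \1_[set z | l2dist y z < t] x = 1 :> R.
  by rewrite indicE mem_set//= l2distC.
rewrite !mule1 -(EFinD (\1_transition x)) -(EFinM l) -(EFinM (_ + 1)).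
rewrite -(EFinD (l * _)) lee_fin.
have dp0 : 0 <= d `^ p by exact: powR_ge0.
have ld : d <= l + l `^ (1 - p) * d `^ p.
  have [dl|ld] := leP d l; first by rewrite ler_wpDr// mulr_ge0.
  apply: ler_wpDl; first exact: ltW.
  have d_gt0 : 0 < d by exact: lt_trans ld.
  have dE : d = d `^ (1 - p) * d `^ p.
    rewrite -powRD; last by rewrite (gt_eqF d_gt0) implybT.
    by rewrite subrK powRr1.
  rewrite {1}dE; apply: ler_wpM2r => //.
  rewrite -opprB !powRN lef_pV2 ?posrE ?powR_gt0//.
  by apply: ge0_ler_powR; rewrite ?nnegrE ?subr_ge0 ?(ltW p1) ?(ltW l0) ?(ltW ld).
have i0 z : 0 <= (\1_transition z : R) by rewrite indicE.
have [xD|xD] := boolP (x \in transition).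
  rewrite [\1_transition x]indicE xD /=.
  have := i0 y; nra.
have [yD|yD] := boolP (y \in transition).
  rewrite [\1_transition y]indicE yD /=.
  have := i0 x; nra.
have w_01 z : l2dist z (tuple_origin n) < r -> z \notin transition -> w z = 0 \/ w z = 1.
  move=> zr; rewrite notin_setE /transition/= => /not_andP[//|].
  move=> /negP; rewrite negb_and -!leNgt; have /andP[z0 z1] := w01 z.
  by move=> /orP[h|h]; [left|right]; apply/le_anti/andP; split.
have dE : d = d `^ p.
  rewrite /d; case: (w_01 x xr xD) => ->; case: (w_01 y yr yD) => ->;
  by rewrite ?subrr ?sub0r ?subr0 ?normrN ?normr0 ?normr1 ?powR1 ?powR0// gt_eqF.
rewrite !indicE (negbTE xD) (negbTE yD)/= addr0 mulr0 add0r.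
by rewrite [leLHS]dE mulrDl mul1r lerDr mulr_ge0.
Qed.

(** For x in the transition region the admissible y lie in a ball of radius t, whose volume does not
    depend on x. The factor 2 accounts for exchanging x and y. *)
Lemma dint_jump1_le p l t : 1 < p -> 0 < l -> 0 < t ->
  (dint (jump 1 t) <= (l * (2 * (t ^+ n * ball_vol R n)))%:E * mu transition +
    (l `^ (1 - p) + 1)%:E * dint (jump p t))%E.
Proof.
move=> p1 l0 t0; have mD := measurable_transition.
pose f x y : \bar R := ((\1_transition x)%:E * (\1_[set z | l2dist x z < t] y)%:E)%E.
have f0 x y : (0 <= f x y)%E by apply: mule_ge0; rewrite lee_fin.
have mf : measurable2 f.
  have E : (fun z : T * T => f z.1 z.2) = (fun z =>
      ((\1_transition z.1)%:E * (\1_[set z | l2dist z.1 z.2 < t] z)%:E)%E).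
    apply/funext => z; rewrite /f !indicE.
    suff -> : (z.2 \in [set y | l2dist z.1 y < t]) =
        (z \in [set z | l2dist z.1 z.2 < t]) by [].
    by apply/idP/idP; rewrite !inE.
  rewrite /measurable2 E; apply: emeasurable_funM.
    apply: (@measurableT_comp _ _ _ _ _ _ (fun x : T => (\1_transition x : R)%:E) _ (@fst T T)) => //.
    by apply/measurable_EFinP; exact: measurable_indic.
  apply/measurable_EFinP; apply: measurable_indic.
  exact: measurable_l2dist_lt.
have Df : (dint f = mu transition * (t ^+ n * ball_vol R n)%:E)%E.
  rewrite /dint -[X in mu X]setIT -(integral_indic _ _ mD)// -ge0_integralZr//; last 2 first.
  - by apply/measurable_EFinP; exact: measurable_indic.
  - by rewrite lee_fin mulr_ge0 ?exprn_ge0 ?(ltW t0)// ltW// ball_vol_gt0.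
  apply: eq_integral => x _; rewrite /f ge0_integralZl//; last first.
    apply/measurable_EFinP; apply: measurable_indic.
    by apply: measurable_l2dist_lt.
  congr (_ * _)%E; rewrite integral_indic//; last by apply: measurable_l2dist_lt.
  by rewrite setIT; exact: borel_lebesgue_l2ball.
have mf' := measurable2_swap mf.
have mJ : measurable2 (jump p t) by exact: measurable2_jump.
have J0 := jump_ge0 r w p t.
have lp0 : 0 <= l `^ (1 - p) + 1 by rewrite addr_ge0// powR_ge0.
have ff0 x y : (0 <= f x y + f y x)%E by exact: adde_ge0.
have mff : measurable2 (fun x y => f x y + f y x)%E by exact: emeasurable_funD.
apply: (@le_trans _ _ (dint (fun x y => l%:E * (f x y + f y x) +
    (l `^ (1 - p) + 1)%:E * jump p t x y)%E)).
  apply: le_dint => x y; first exact: jump_ge0.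
  exact: jump_le_split.
have l1 x y : (0 <= l%:E * (f x y + f y x))%E by rewrite mule_ge0// lee_fin ltW.
have l2 x y : (0 <= (l `^ (1 - p) + 1)%:E * jump p t x y)%E by rewrite mule_ge0.
rewrite (dintD l1 _ l2); last 2 first.
- exact: measurable_funeM.
- exact: measurable_funeM.
rewrite (dintZ (ltW l0) ff0 mff) (dintZ lp0 J0 mJ).
rewrite (dintD f0 mf (fun x y => f0 y x) mf') (dint_swap f0 mf) Df.
rewrite -[in X in (_ <= X + _)%E](muleC (mu _)) leeD2r//.
rewrite -ge0_muleDr ?lee_fin ?mulr_ge0 ?exprn_ge0 ?(ltW t0) ?(ltW (ball_vol_gt0 _ _))//.
rewrite muleCA -EFinD -EFinM.
rewrite le_eqVlt; apply/orP; left; apply/eqP; congr (_ * (_)%:E)%E; ring.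
Qed.

End transition_region.

Lemma pmule_lty (R : realType) (c : R) (x y : \bar R) :
  0 < c -> (c%:E * x <= y)%E -> (y < +oo)%E -> (x < +oo)%E.
Proof.
move=> c0 cxy yoo; rewrite ltey; apply/eqP => x_oo.
by move: (le_lt_trans cxy yoo); rewrite x_oo gt0_muley ?lte_fin// ltxx.
Qed.

Section borel_isoperimetric_inequality.
Context (R : realType) (n : nat) (r : R) (w : n.-tuple R -> R).
Hypotheses (mw : measurable_fun setT w) (w01 : forall x, 0 <= w x <= 1).
Notation T := (n.-tuple R).
Notation mu := (borel_lebesgue R n).

(** What remains before [isoperimetric_assembly] is finiteness, obtained in a chain: [E] from the
    energy bound, the integral of [jump p] from [E], that of [jump 1] from the splitting at l = 1,
    then the chain terms. *)
Lemma borel_isoperimetric (p M g1 g2 s : R) (N : nat)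
    (A := tball n r `&` [set x | w x == 0])
    (B := tball n r `&` [set x | w x == 1])
    (E := dint (gagliardo r w p (n%:R + s * p))) :
  (2 <= n)%N -> (0 < N)%N -> 1 < p -> 0 < s < 1 -> 0 < r -> 0 < g1 -> 0 < g2 ->
  (((1 - s) * r `^ (s * p))%:E * E <= (M * r ^+ n)%:E)%E ->
  (g1%:E * mu (tball n r) <= mu A)%E ->
  (g2%:E * mu (tball n r) <= mu B)%E ->
  2 <= g1 * N%:R -> 2 <= g2 * N%:R ->
  4 ^+ n.+1 * energy_const n p * M / ball_vol R n ^+ 2 * N%:R `^ (1 - p)
    <= g1 * g2 / 2 ->
  p * (1 - s) <= N%:R^-1 ->
  ((mu A * mu B) `^ ((n%:R - 1) / n%:R) <=
   (iso_const n p (ball_vol R n) * r `^ (n%:R - 2 + s) * (1 - s) `^ p^-1)%:E *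
   (E `^ p^-1 * mu (transition r w) `^ ((p - 1) / p)))%E.
Proof.
move=> n2 N0 p1 s01 r0 g10 g20 hM hA hB gN1 gN2 hN hs.
have n0 : (0 < n)%N by exact: ltnW.
have /andP[s0 s1] := s01.
have N_gt0 : 0 < N%:R :> R by rewrite ltr0n.
have om0 := ball_vol_gt0 R n.
set V := r ^+ n * ball_vol R n.
have muV : mu (tball n r) = V%:E by exact: borel_lebesgue_tball.
have mb := @measurable_tball R n r.
have mA : measurable A.
  apply: (@measurable_level R n r w mw (fun u => u == 0)).
  by rewrite (_ : [set _ | _] = [set 0])//; apply/seteqP; split => u /= /eqP.
have mB : measurable B.
  apply: (@measurable_level R n r w mw (fun u => u == 1)).
  by rewrite (_ : [set _ | _] = [set 1])//; apply/seteqP; split => u /= /eqP.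
have mD := measurable_transition r mw.
have finb S : measurable S -> S `<=` tball n r ->
    mu S = (fine (mu S))%:E /\ fine (mu S) <= V.
  move=> mS Sb; have h : (mu S <= V%:E)%E.
    by rewrite -muV; apply: le_measure; rewrite ?inE.
  have f : mu S \is a fin_num by rewrite ge0_fin_numE// (le_lt_trans h)// ltry.
  by rewrite fineK//; split => //; rewrite -lee_fin fineK.
have Ab : A `<=` tball n r by move=> x [].
have Bb : B `<=` tball n r by move=> x [].
have [EA AV] := finb _ mA Ab; have [EB BV] := finb _ mB Bb.
have [ED DV] : mu (transition r w) = (fine (mu (transition r w)))%:E /\
  fine (mu (transition r w)) <= V by apply: finb => // x [].
have c0 : 0 < (1 - s) * r `^ (s * p) by rewrite mulr_gt0 ?powR_gt0// subr_gt0.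
have E_ge0 : (0 <= E)%E by apply: dint_ge0; exact: gagliardo_ge0.
have EE : E = (fine E)%:E.
  by rewrite fineK// ge0_fin_numE//; apply: (pmule_lty c0 hM); exact: ltry.
pose t := 4 * r / N%:R.
have t0 : 0 < t by rewrite divr_gt0// mulr_gt0.
have hF := dint_jump_le_gagliardo r mw n0 (ltW p1) s01 t0.
have F_ge0 : (0 <= dint (jump r w p t))%E by apply: dint_ge0; exact: jump_ge0.
have EF : dint (jump r w p t) = (fine (dint (jump r w p t)))%:E.
  rewrite fineK// ge0_fin_numE//; apply: le_lt_trans hF _.
  by rewrite -/E EE -EFinM ltry.
have I_ge0 : (0 <= dint (jump r w 1 t))%E by apply: dint_ge0; exact: jump_ge0.
have hI l : 0 < l -> _ := fun l0 => dint_jump1_le r mw w01 p1 l0 t0.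
have EI : dint (jump r w 1 t) = (fine (dint (jump r w 1 t)))%:E.
  rewrite fineK; first by [].
  rewrite (ge0_fin_numE I_ge0); apply: le_lt_trans (hI 1 ltr01) _.
  by rewrite ED EF -!EFinM -EFinD ltry.
have T_ge0 i : (0 <= chain_term r w N A B i)%E.
  by apply: dint_ge0 => x y; rewrite mule_ge0 ?lee_fin ?mulr_ge0// local_osc_ge0.
have hTA i := chain_term_le_left r mw N0 B mA i n0.
have hTB i := @chain_term_le_right R n r w N mw N0 A B mA mB i n0.
(* At i = 0 the left bound has a zero factor and says nothing, so the right bound replaces it. *)
have ET i : chain_term r w N A B i = (fine (chain_term r w N A B i))%:E.
  apply/esym/fineK; rewrite (ge0_fin_numE (T_ge0 i)); have [->|i0] := posnP i.
    have := hTB 0%N (leq0n _); rewrite mul0r subr0 expr1n mul1e => /le_lt_trans; apply.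
    by rewrite -/t EB EI -EFinM ltry.
  apply: (pmule_lty _ (hTA i)); first by rewrite exprn_gt0// divr_gt0// ltr0n.
  by rewrite -/t EA EI -EFinM ltry.
have hT : (mu A * mu B * V%:E <= (N%:R ^+ n)%:E *
    \sum_(i < N) (chain_term r w N A B i + chain_term r w N A B i.+1))%E.
  apply: measure_prod_le_chain => //; first by move=> x [_ /eqP].
  by move=> x [_ /eqP].
rewrite EA EB ED EE -EFinM !poweR_EFin -!EFinM lee_fin.
apply: (@isoperimetric_assembly R n p M g1 g2 s r (ball_vol R n) _ _ _ _
  (fine (dint (jump r w 1 t))) (fine (dint (jump r w p t))) N
  (fun i => fine (chain_term r w N A B i)) n2 N0 p1 s01 r0 om0 g10 g20).
all: rewrite ?gN1 ?gN2 ?hN ?hs; try exact: isT.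
- by rewrite -/V AV andbT -lee_fin EFinM -muV -EA.
- by rewrite -/V BV andbT -lee_fin EFinM -muV -EB.
- exact: (fine_ge0 (measure_ge0 _ _)).
- exact: (fine_ge0 E_ge0).
- exact: (fine_ge0 I_ge0).
- by rewrite -lee_fin -EF EFinM -EE.
- by move=> l l0; rewrite -lee_fin -EI EFinD !EFinM -ED -EF -EFinM; exact: hI.
- rewrite -/V -lee_fin !EFinM -EA -EB.
  rewrite -sumEFin (eq_bigr (fun i : 'I_N =>
    (chain_term r w N A B i + chain_term r w N A B i.+1)%E)); first by apply: hT.
  move=> i _; rewrite EFinD; congr (_ + _)%E.
    exact: (esym (ET i)).
  exact: (esym (ET i.+1)).
- by move=> i; exact: (fine_ge0 (T_ge0 i)).
- move=> i iN; rewrite -lee_fin !EFinM -(ET i) -EA -EI; exact: hTA.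
- move=> i iN; rewrite -lee_fin !EFinM -(ET i) -EB -EI; exact: hTB.
- by rewrite -lee_fin EFinM -EE.
Qed.

End borel_isoperimetric_inequality.

(** * Passage to the completed measure *)

Section borel_hull.
Context d (T : measurableType d) (R : realType) (mu : {measure set T -> \bar R}).
Local Open Scope ereal_scope.

(** Intersect over j the unions of countable measurable covers whose total measure exceeds the outer
    measure by less than 1/(j+1). *)
Lemma outer_measure_hull (X : set T) : (mu^*)%mu X < +oo ->
  exists F : set T, [/\ measurable F, X `<=` F & mu F <= (mu^*)%mu X].
Proof.
move=> Xoo.
have inv0 j : (0 < j.+1%:R^-1 :> R)%R by rewrite invr_gt0.
have cover j : exists A : (set T)^nat, measurable_cover X A /\
    \sum_(0 <= k <oo) mu (A k) < (mu^*)%mu X + j.+1%:R^-1%:E.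
  have : (mu^*)%mu X \is a fin_num by rewrite ge0_fin_numE// mu_ext_ge0.
  by move/lb_ereal_inf_adherent => /(_ _ (inv0 j))[_/= [A XA] <-] ?; exists A.
have /choice [A hA] := cover.
exists (\bigcap_j \bigcup_k A j k); split.
- apply: bigcapT_measurable => j; apply: bigcupT_measurable => k.
  exact: (cover_measurable (hA j).1).
- by move=> x Xx j _; exact: (cover_subset (hA j).1).
- apply/lee_addgt0Pr => e e0.
  have [j _ je] : exists2 j, True & (j.+1%:R^-1 <= e)%R.
    exists (Num.truncn e^-1) => //.
    by rewrite -[leRHS]invrK lef_pV2 ?posrE ?invr_gt0// ltW// truncnS_gt.
  apply: le_trans (_ : \sum_(0 <= k <oo) mu (A j k) <= _).
    apply: (@le_trans _ _ (mu (\bigcup_k A j k))).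
      apply: le_measure; rewrite ?inE.
      + apply: bigcapT_measurable => i; apply: bigcupT_measurable => k.
        exact: (cover_measurable (hA i).1).
      + by apply: bigcupT_measurable => k; exact: (cover_measurable (hA j).1).
      + exact: bigcap_inf.
    apply: measure_sigma_subadditive => //.
    - by move=> k; exact: (cover_measurable (hA j).1).
    - by apply: bigcupT_measurable => k; exact: (cover_measurable (hA j).1).
  apply: le_trans (ltW (hA j).2) _.
  by rewrite leeD2l// lee_fin.
Qed.

(** Testing the measurability of [E] on its hull [F] and cancelling the finite outer measure of [E]
    shows that [F] minus [E] is null; [G] is a hull of this difference. *)
Lemma caratheodory_borel_modulo_null (E : set T) :
  ((mu^*)%mu.-cara.-measurable E)%mu -> (mu^*)%mu E < +oo ->
  exists F G : set T, [/\ measurable F, measurable G, mu G = 0 &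
    forall x, ~ G x -> (E x <-> F x)].
Proof.
move=> mE Eoo; have [F [mF EF FE]] := outer_measure_hull Eoo.
have FmE : (mu^*)%mu F = mu F by exact: measurable_mu_extE.
have D0 : (mu^*)%mu (F `\` E) = 0.
  have FD : mu F = (mu^*)%mu E + (mu^*)%mu (F `\` E).
    by rewrite -FmE (mE F) (setIidr EF) setDE.
  have Efin : (mu^*)%mu E \is a fin_num by rewrite ge0_fin_numE// mu_ext_ge0.
  apply/le_anti/andP; split; last exact: mu_ext_ge0.
  by rewrite -(leeD2lE _ _ Efin) adde0 -FD.
have [|G [mG DG G0]] := @outer_measure_hull (F `\` E); first by rewrite D0.
exists F, G; split => //.
  by apply/eqP; rewrite eq_le measure_ge0 andbT -D0.
move=> x Gx; split; first exact: EF.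
by move=> Fx; apply: contrapT => Ex; apply: Gx; exact: DG.
Qed.

End borel_hull.

Section completion.
Context (R : realType) (n : nat).
Notation T := (n.-tuple R).
Notation mu := (borel_lebesgue R n).

Lemma measurable_Rn (A : set T) : measurable A -> measurable (A : set (Rn R n)).
Proof. by move=> mA; exact: caratheodory_measurable_mu_ext. Qed.

Lemma lebesgueE (A : set T) : measurable A -> lebesgue n (A : set (Rn R n)) = mu A.
Proof. by move=> mA; exact: measurable_mu_extE. Qed.

(** [lebesgue n] is the outer measure on all sets, so X and Y can be arbitrary: monotonicity and
    subadditivity give the bound. *)
Lemma lebesgue_null_le (N0 X Y : set T) : measurable N0 -> mu N0 = 0%E ->
  (forall x, ~ N0 x -> X x -> Y x) ->
  (lebesgue n (X : set (Rn R n)) <= lebesgue n (Y : set (Rn R n)))%E.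
Proof.
move=> mN N00 XY; apply: (@le_trans _ _ ((mu^*)%mu (Y `|` N0))).
  apply: le_outer_measure => x Xx.
  by have [Nx|Nx] := pselect (N0 x); [right|left; exact: XY].
apply: le_trans (outer_measureU2 _ _ _) _.
rewrite [X in (_ + X)%E](_ : _ = 0%E) ?adde0//.
by rewrite -N00; exact: measurable_mu_extE.
Qed.

Lemma integral_lebesgue (f : T -> \bar R) :
  measurable_fun setT f -> (forall x, 0 <= f x)%E ->
  (\int[lebesgue n]_x f x = \int[mu]_x f x)%E.
Proof.
move=> mf f0.
pose phi : Rn R n -> T := fun x => x.
have mphi : measurable_fun setT phi.
  by move=> _ Y mY; rewrite setTI; exact: measurable_Rn.
transitivity (\int[pushforward (@lebesgue R n) phi]_x f x)%E.
  by rewrite ge0_integral_pushforward.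
by apply: eq_measure_integral => A mA _; exact: lebesgueE.
Qed.

(** The Borel function [f] is cut to 0 on the null set, which leaves its integral unchanged and
    makes the inequality hold everywhere; then [ge0_le_integral_all] applies to an arbitrary [g]. *)
Lemma le_integral_lebesgue (N0 : set T) (f g : T -> \bar R) :
  measurable N0 -> mu N0 = 0%E ->
  measurable_fun setT f -> (forall x, 0 <= f x)%E -> (forall x, 0 <= g x)%E ->
  (forall x, ~ N0 x -> f x <= g x)%E ->
  (\int[mu]_x f x <= \int[lebesgue n]_x (g : Rn R n -> \bar R) x)%E.
Proof.
move=> mN N00 mf f0 g0 fg.
rewrite (ge0_negligible_integral mN)//.
rewrite integral_mkcond -integral_lebesgue; last 2 first.
- by apply/(measurable_restrictT _ _).1; [exact: measurableD|exact: measurable_funTS].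
- by move=> x; exact: erestrict_ge0.
apply: ge0_le_integral_all => x; first exact: erestrict_ge0.
rewrite patchE; case: ifPn => [|_]; last exact: g0.
by rewrite inE => -[_ Nx]; exact: fg.
Qed.

(** Each rational superlevel set of v in [O] is Borel up to a null set; finite measure of [O]
    provides the hulls. Off the countable union of these null sets, the superlevel set at c >= 0 is
    the union of those at rationals q >= c. *)
Lemma borel_representative (O : set T) (v : T -> R) :
  measurable O -> (mu O < +oo)%E -> (forall x, 0 <= v x) ->
  measurable_fun (O : set (Rn R n)) (v : Rn R n -> R) ->
  exists N0 : set T, [/\ measurable N0, mu N0 = 0%E &
    measurable_fun setT (fun x => if x \in O `\` N0 then v x else 0)].
Proof.
move=> mO Ooo v0 mv.
pose E (q : rat) : set T := O `&` [set x | ratr q < v x].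
have mE q : measurable (E q : set (Rn R n)).
  have := mv (measurable_Rn mO) `]ratr q, +oo[%classic.
  move=> /(_ (measurable_itv _)); congr measurable; apply/seteqP.
  by split => x [Ox /=]; rewrite in_itv/= andbT.
have Eoo q : ((mu^*)%mu (E q) < +oo)%E.
  apply: le_lt_trans Ooo; rewrite -(lebesgueE mO).
  by apply: le_outer_measure => x [].
have hull q : exists FG : set T * set T, [/\ measurable FG.1, measurable FG.2,
    mu FG.2 = 0%E & forall x, ~ FG.2 x -> (E q x <-> FG.1 x)].
  have [F [G H]] := caratheodory_borel_modulo_null (mE q) (Eoo q).
  by exists (F, G).
have /choice [FG hFG] := hull.
(* An enumeration of the rationals; indices that code no rational give 0, which only repeats a set
   in the union. *)
pose rat_of (j : nat) : rat := odflt 0 (unpickle j).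
pose N0 : set T := \bigcup_j (FG (rat_of j)).2.
have mN : measurable N0.
  by apply: bigcupT_measurable => j; have [] := hFG (rat_of j).
have N00 : mu N0 = 0%E.
  apply: measure_negligible => //; apply: negligible_bigcup => j.
  by have [_ mG G0 _] := hFG (rat_of j); exists (FG (rat_of j)).2; split.
have EF q x : ~ N0 x -> E q x <-> (FG q).1 x.
  move=> Nx; have [_ _ _] := hFG q; apply => Gx; apply: Nx.
  by exists (pickle q) => //; rewrite /rat_of pickleK.
exists N0; split => //.
move=> _; apply: (measurability _ (RGenOInfty.measurableE R)) => //.
move=> /= _ [_ [c ->] <-]; rewrite setTI.
(* Below level 0 the superlevel set is everything: v is nonnegative and the value elsewhere is 0. *)
have [c0|c0] := ltP c 0.
  rewrite (_ : _ @^-1` _ = setT)//; apply/seteqP; split => // x _ /=.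
  by rewrite in_itv/= andbT; case: ifP => // _; exact: lt_le_trans (v0 x).
rewrite (_ : _ @^-1` _ = \bigcup_(q in [set q : rat | c <= ratr q])
    ((O `\` N0) `&` (FG q).1)).
  rewrite bigcup_mkcond; apply: bigcupT_measurable_rat => q.
  case: ifP => // _; apply: measurableI; first exact: measurableD.
  by have [] := hFG q.
apply/seteqP; split => x /=.
  rewrite in_itv/= andbT; case: ifPn => [|_]; last by rewrite ltNge c0.
  rewrite inE => -[Ox Nx] /rat_in_itvoo[q]; rewrite in_itv/= => /andP[cq qv].
  exists q; first exact: ltW.
  by split => //; apply/EF.
move=> [q /= cq [[Ox Nx]]] /(EF q x Nx)[_ /= qv].
by rewrite mem_set// in_itv/= andbT; exact: le_lt_trans qv.
Qed.

End completion.

(** * Truncation between the levels h and k *)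

Section truncation.
Context (R : realType) (h k : R).
Hypothesis hk : h < k.

Definition truncate (z : R) : R := Num.min 1 (Num.max 0 ((z - h) / (k - h))).

Let kh0 : 0 < k - h. Proof. by rewrite subr_gt0. Qed.

Lemma truncate_bounds z : 0 <= truncate z <= 1.
Proof.
by rewrite /truncate; apply/andP; split;
  [rewrite le_min ler01 le_max lexx|rewrite ge_min lexx].
Qed.

Lemma truncate_eq0 z : (truncate z == 0) = (z <= h).
Proof.
rewrite /truncate; have [zh|hz] := leP z h.
  rewrite max_l; last by rewrite pmulr_lle0 ?invr_gt0// subr_le0.
  by rewrite min_r ?eqxx.
have q0 : 0 < (z - h) / (k - h) by rewrite divr_gt0// subr_gt0.
by rewrite max_r ?(ltW q0)// gt_eqF// lt_min ltr01.
Qed.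

Lemma truncate_eq1 z : (truncate z == 1) = (k <= z).
Proof.
rewrite /truncate; have [kz|zk] := leP k z.
  have q1 : 1 <= (z - h) / (k - h) by rewrite ler_pdivlMr// mul1r lerD2r.
  by rewrite min_l ?eqxx// le_max q1 orbT.
have q1 : (z - h) / (k - h) < 1 by rewrite ltr_pdivrMr// mul1r ltrD2r.
have m1 : Num.max 0 ((z - h) / (k - h)) < 1 by rewrite gt_max ltr01.
by rewrite min_r ?(ltW m1)// lt_eqF.
Qed.

Lemma truncate_in01 z : (0 < truncate z < 1) = (h < z < k).
Proof.
have /andP[t0 t1] := truncate_bounds z.
rewrite [0 < truncate z]lt_neqAle [truncate z < 1]lt_neqAle t0 t1 !andbT.
by rewrite eq_sym truncate_eq0 truncate_eq1 -!ltNge.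
Qed.

Lemma truncate_lipschitz y z : (k - h) * `|truncate y - truncate z| <= `|y - z|.
Proof.
have H (a b : R) : `|Num.min 1 (Num.max 0 a) - Num.min 1 (Num.max 0 b)| <= `|a - b|.
  have n1 := ler_norm (a - b); have n2 := ler_norm (b - a).
  rewrite distrC in n2; rewrite ler_norml.
  case: (leP 0 a) => a0; case: (leP 0 b) => b0.
  - by case: (leP 1 a) => a1; case: (leP 1 b) => b1; apply/andP; split; lra.
  - by case: (leP 1 a) => a1; rewrite (@min_r _ _ 1 0)//; apply/andP; split; lra.
  - by case: (leP 1 b) => b1; rewrite (@min_r _ _ 1 0)//; apply/andP; split; lra.
  - by apply/andP; split; lra.
apply: le_trans (ler_wpM2l (ltW kh0) (H _ _)) _.
rewrite -mulrBl normrM [`|(k - h)^-1|]gtr0_norm ?invr_gt0// mulrCA mulfV ?gt_eqF// mulr1.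
by rewrite opprB addrA subrK.
Qed.

Lemma measurable_truncate : measurable_fun setT truncate.
Proof.
apply: measurable_minr => //; apply: measurable_maxr => //.
by apply: measurable_funM => //; exact: measurable_funB.
Qed.

End truncation.

(** * Comparison of u with a Borel version of its truncation *)

Section transfer.
Context (R : realType) (n : nat) (r : R) (h k : R) (u : n.-tuple R -> R).
Hypotheses (hk : h < k).
Notation T := (n.-tuple R).
Notation mu := (borel_lebesgue R n).
Variables (N0 : set T) (w : T -> R).
Hypotheses (mN : measurable N0) (N00 : mu N0 = 0%E) (mw : measurable_fun setT w).
Hypothesis wE : forall x, tball n r x -> ~ N0 x -> w x = truncate h k (u x).

(** The truncation is Lipschitz with constant 1/(k-h). The null set is discarded in each variable in
    turn, so the iterated integral over the completed measure is compared without Tonelli for that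
    measure. *)
Lemma gagliardo_truncate_le p a : 0 < p ->
  (((k - h) `^ p)%:E * dint (gagliardo r w p a) <=
   \int[lebesgue n]_(y in (tball n r : set (Rn R n)))
     \int[lebesgue n]_(x in (tball n r : set (Rn R n)))
     (`|u x - u y| `^ p / euclid_dist (x : Rn R n) y `^ a)%:E)%E.
Proof.
move=> p0; have c0 : 0 <= (k - h) `^ p by exact: powR_ge0.
have mg := measurable2_gagliardo r mw p a.
have g0 := gagliardo_ge0 r w p a.
have ker0 x y : (0 <= (`|u x - u y| `^ p / euclid_dist (x : Rn R n) y `^ a)%:E)%E.
  by rewrite lee_fin divr_ge0 ?powR_ge0.
have mG : measurable_fun setT (fun y => \int[mu]_x gagliardo r w p a y x)%E.
  exact: measurable2_integral.
have G0 y : (0 <= \int[mu]_x gagliardo r w p a y x)%E by exact: integral_ge0.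
rewrite /dint -ge0_integralZl//.
rewrite [leRHS]integral_mkcond.
apply: (le_integral_lebesgue mN N00).
- exact: measurable_funeM.
- by move=> y; exact: mule_ge0.
- by move=> y; apply: erestrict_ge0 => y' _; apply: integral_ge0 => x _; exact: ker0.
move=> y Ny; rewrite patchE; case: ifPn => yr; last first.
  rewrite integral0_eq ?mule0// => x _; rewrite /gagliardo.
  case: ifPn => // /andP[yr' _]; exfalso; move: yr => /negP; apply; exact/mem_set.
have yr' : tball n r y by exact: set_mem.
have my : measurable_fun setT (gagliardo r w p a y) by exact: measurable2_slice.
rewrite -ge0_integralZl//.
rewrite [leRHS]integral_mkcond.
apply: (le_integral_lebesgue mN N00).
- exact: measurable_funeM.
- by move=> x; exact: mule_ge0.
- by move=> x; apply: erestrict_ge0 => x' _; exact: ker0.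
move=> x Nx; rewrite patchE; case: ifPn => xr; last first.
  rewrite /gagliardo; case: ifPn => [/andP[_ xr']|_]; last by rewrite mule0.
  by exfalso; move: xr => /negP; apply; exact/mem_set.
have xr' : tball n r x by exact: set_mem.
rewrite /gagliardo; have -> : l2dist y (tuple_origin n) < r by [].
have -> : l2dist x (tuple_origin n) < r by [].
rewrite /= -EFinM lee_fin l2distC mulrA; apply: ler_wpM2r.
  by rewrite invr_ge0 powR_ge0.
rewrite -powRM ?subr_ge0 ?(ltW hk)//.
apply: ge0_ler_powR; rewrite ?nnegrE ?mulr_ge0 ?subr_ge0 ?(ltW hk) ?(ltW p0)//.
by rewrite wE// wE// [leRHS]distrC; exact: truncate_lipschitz.
Qed.

Lemma lebesgue_level (P Q : R -> bool) : measurable [set z : R | Q z] ->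
  (forall z, Q (truncate h k z) = P z) ->
  lebesgue n ((tball n r : set (Rn R n)) `&` [set x | P (u x)]) =
  mu (tball n r `&` [set x | Q (w x)]).
Proof.
move=> mQ QP; have mS := measurable_level r mw mQ.
rewrite -(lebesgueE mS); apply/le_anti/andP; split.
  apply: (lebesgue_null_le mN N00) => x Nx [xr Px]; split => //=.
  by rewrite wE// QP.
apply: (lebesgue_null_le mN N00) => x Nx [xr /= Qx]; split => //=.
by rewrite -QP -wE.
Qed.

End transfer.

(** * Choice of the scale and conclusion *)

Lemma exists_scale (R : realType) (p g1 g2 K : R) :
  1 < p -> 0 < g1 -> 0 < g2 -> 0 < K ->
  exists N : nat, [/\ (0 < N)%N, 2 <= g1 * N%:R, 2 <= g2 * N%:R &
    K * N%:R `^ (1 - p) <= g1 * g2 / 2].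
Proof.
move=> p1 g10 g20 K0.
(* The last condition on N amounts to N^(p-1) >= [Y], that is, to N >= [X] below. *)
pose Y := 2 * K / (g1 * g2).
have Y0 : 0 < Y by rewrite divr_gt0 ?mulr_gt0.
pose X := Y `^ (p - 1)^-1.
have X0 : 0 <= X by exact: powR_ge0.
pose N := (Num.truncn (2 / g1 + 2 / g2 + X)).+1.
have a1 : 0 < 2 / g1 by rewrite divr_gt0.
have a2 : 0 < 2 / g2 by rewrite divr_gt0.
have XN : 2 / g1 + 2 / g2 + X < N%:R by rewrite truncnS_gt.
have N_gt0 : 0 < N%:R :> R by rewrite ltr0n.
exists N; split => //.
- by rewrite mulrC -ler_pdivrMr//; lra.
- by rewrite mulrC -ler_pdivrMr//; lra.
have p10 : 0 < p - 1 by rewrite subr_gt0.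
have YN : Y <= N%:R `^ (p - 1).
  have -> : Y = X `^ (p - 1) by rewrite -powRrM mulVf ?gt_eqF// powRr1// ltW.
  by apply: ge0_ler_powR; rewrite ?nnegrE ?(ltW p10) ?(ltW N_gt0)//; lra.
rewrite -opprB powRN ler_pdivrMr ?powR_gt0//.
have g0 : 0 <= g1 * g2 / 2 by rewrite divr_ge0// mulr_ge0 ?ltW.
apply: le_trans (ler_wpM2l g0 YN).
by rewrite le_eqVlt; apply/orP; left; apply/eqP; rewrite /Y; field; rewrite !gt_eqF.
Qed.

Unset Implicit Arguments.
Set Strict Implicit.

Theorem proposition5p1 (R : realType) (n : nat) (p : R)
    (hn : (2 <= n)%N) (hp : 1 < p) :
  exists2 C : R, 0 < C &
  forall M gamma1 gamma2 : R,
    0 < M -> 0 < gamma1 < 1 -> 0 < gamma2 < 1 ->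
  exists2 sbar : R, 0 < sbar < 1 &
  forall s r : R, sbar <= s < 1 -> 0 < r ->
  forall (h k : R) (u : Rn R n -> R),
    h < k ->
    sobolevW s p (eball n r) u ->
    (Lp_norm p (eball n r) u `^ p
       + ((1 - s) * r `^ (s * p))%:E * seminormW s p (eball n r) u `^ p
     <= (M * r ^+ n * (k - h) `^ p)%:E)%E ->
    (lebesgue n (eball n r `&` [set x | (u x <= h)%R])
     >= gamma1%:E * lebesgue n (eball n r))%E ->
    (lebesgue n (eball n r `&` [set x | (u x >= k)%R])
     >= gamma2%:E * lebesgue n (eball n r))%E ->
    ((k - h)%:E
       * (lebesgue n (eball n r `&` [set x | (u x <= h)%R])
          * lebesgue n (eball n r `&` [set x | (u x >= k)%R]))
           `^ ((n%:R - 1) / n%:R)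
     <= (C * r `^ (n%:R - 2 + s) * (1 - s) `^ p^-1)%:E
        * seminormW s p (eball n r) u
        * lebesgue n (eball n r `&` [set x | (h < u x < k)%R])
            `^ ((p - 1) / p))%E.
Proof.
have om0 := ball_vol_gt0 R n.
have p0 : 0 < p by exact: lt_trans hp.
exists (iso_const n p (ball_vol R n)); first exact: iso_const_gt0.
move=> M g1 g2 M0 /andP[g10 _] /andP[g20 _].
have K0 : 0 < 4 ^+ n.+1 * energy_const n p * M / ball_vol R n ^+ 2.
  by rewrite divr_gt0 ?exprn_gt0// !mulr_gt0 ?exprn_gt0// energy_const_gt0.
have [N [N0 gN1 gN2 hN]] := exists_scale hp g10 g20 K0.
have N_gt0 : 1 <= N%:R :> R by rewrite ler1n.
have pN1 : 1 < p * N%:R by apply: lt_le_trans hp _; rewrite ler_peMr// ltW.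
have pN0 : 0 < p * N%:R by exact: lt_trans pN1.
(* Beyond this value p (1 - s) <= 1/N, which keeps N^(p(1-s)) at most 2. *)
exists (1 - (p * N%:R)^-1).
  by rewrite subr_gt0 invf_lt1// pN1/= ltrBlDr ltrDl invr_gt0.
move=> s r /andP[sb s1] r0 h k u hk [mu_ _ _] hM hA hB.
have s01 : 0 < s < 1.
  by rewrite s1 andbT; apply: lt_le_trans sb; rewrite subr_gt0 invf_lt1.
have hs : p * (1 - s) <= N%:R^-1.
  rewrite -ler_pdivlMl// -invfM mulrC; first by rewrite mulrC; lra.
have kh0 : 0 < k - h by rewrite subr_gt0.
pose v x := truncate h k (u x).
have mv : measurable_fun (tball n r : set (Rn R n)) (v : Rn R n -> R).
  by apply: (measurableT_comp (measurable_truncate h k)).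
have v01 x : 0 <= v x <= 1 by exact: truncate_bounds.
have v0 x : 0 <= v x by have /andP[] := v01 x.
have [Z [mZ Z0 mw]] := borel_representative (@measurable_tball R n r)
  (borel_lebesgue_tball_lty n r0) v0 mv.
set w := (fun x => _) in mw.
have wE x : tball n r x -> ~ Z x -> w x = v x.
  by move=> xr xZ; rewrite /w mem_set.
have w01 x : 0 <= w x <= 1.
  by rewrite /w; case: ifP => // _; rewrite lexx ler01.
pose S := (\int[lebesgue n]_(y in (tball n r : set (Rn R n)))
     \int[lebesgue n]_(x in (tball n r : set (Rn R n)))
     (`|u x - u y| `^ p / euclid_dist (x : Rn R n) y `^ (n%:R + s * p))%:E)%E.
have S0 : (0 <= S)%E.
  apply: integral_ge0 => y _; apply: integral_ge0 => x _.
  by rewrite lee_fin divr_ge0 ?powR_ge0.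
have WE : seminormW s p (eball n r) u = (S `^ p^-1)%E by [].
have WpE : (seminormW s p (eball n r) u `^ p)%E = S.
  by rewrite WE -poweRrM mulVf ?gt_eqF// poweRe1.
have ES := gagliardo_truncate_le hk mZ Z0 mw wE (n%:R + s * p) p0.
set E := dint _ in ES.
have m1 (c : R) : measurable [set z : R | z == c].
  by rewrite (_ : [set _ | _] = [set c])//; apply/seteqP; split => z /= /eqP.
have lA := lebesgue_level mZ Z0 mw wE (m1 0) (truncate_eq0 hk).
have lB := lebesgue_level mZ Z0 mw wE (m1 1) (truncate_eq1 hk).
have m01 : measurable [set z : R | 0 < z < 1].
  by rewrite (_ : [set _ | _] = `]0, 1[%classic).
have lD := lebesgue_level mZ Z0 mw wE m01 (truncate_in01 hk).
have lO : lebesgue n (eball n r) = borel_lebesgue R n (tball n r).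
  by apply: lebesgueE; exact: measurable_tball.
rewrite lA lO in hA; rewrite lB lO in hB; rewrite lA lB lD.
have cp0 : 0 < (k - h) `^ p by exact: powR_gt0.
have E0 : (0 <= E)%E by apply: dint_ge0; exact: gagliardo_ge0.
have q0 : 0 <= (1 - s) * r `^ (s * p).
  by rewrite mulr_ge0 ?powR_ge0// subr_ge0 ltW.
(* Multiplied by (k-h)^p, the energy of [w] is at most that of u, so the power (k-h)^p in the
   assumption cancels. *)
have hE : (((1 - s) * r `^ (s * p))%:E * E <= (M * r ^+ n)%:E)%E.
  rewrite -(@lee_pmul2l _ ((k - h) `^ p)%:E)// ?lte_fin//.
  rewrite muleCA -EFinM [((k - h) `^ p * _)%R]mulrC.
  apply: le_trans (lee_wpmul2l _ ES) _; first by rewrite lee_fin.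
  by apply: le_trans hM; rewrite WpE leeDr// poweR_ge0.
have H := borel_isoperimetric mw w01 hn N0 hp s01 r0 g10 g20 hE hA hB gN1 gN2 hN hs.
rewrite -/E in H.
have kh_ge0 : (0 <= (k - h)%:E)%E by rewrite lee_fin ltW.
apply: le_trans (lee_wpmul2l kh_ge0 H) _.
rewrite muleCA -muleA; apply: lee_wpmul2l.
  rewrite lee_fin; apply: mulr_ge0; last exact: powR_ge0.
  by apply: mulr_ge0; [exact/ltW/iso_const_gt0|exact: powR_ge0].
rewrite muleA WE; apply: lee_wpmul2r; first exact: poweR_ge0.
(* The factor k - h is moved under the p-th root, where [ES] compares the energies of [w] and u. *)
have -> : ((k - h)%:E * E `^ p^-1 = (((k - h) `^ p)%:E * E) `^ p^-1)%E.
  rewrite poweRM ?lee_fin ?powR_ge0// poweR_EFin -powRrM mulfV ?gt_eqF//.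
  by rewrite powRr1// ltW.
apply: gt0_ler_poweR => //; first by rewrite invr_ge0 ltW.
- by rewrite in_itv/= mule_ge0 ?leey// lee_fin ltW.
- by rewrite in_itv/= S0 leey.
Qed.
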